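(* Let $H$ be a Hilbert space and let $A$ be the generator of a $C_0$-semigroup $\{S(t)\}_{t\geq 0}$ on $H$ for which there are constants $M,\omega>0$ with $$\|S(t)\|_{\mathcal L(H)}\leq M e^{\omega t},\qquad t\geq 0.$$ For every $i\in\mathbb N=\{1,2,\dots\}$ let $\tau_i:[0,+\infty)\to[0,+\infty)$ be differentiable with $\tau_i'(t)\leq c_i<1$ for all $t\geq 0$, where $c_i$ is a real constant, let $B_i:H\to H$ be a bounded linear operator with norm $b_i:=\|B_i\|_{\mathcal L(H)}$, and let $k_i\in L^1_{loc}([0,+\infty))$ be real-valued. Let $F:H\to H$ be Lipschitz continuous with constant $L>0$ and $F(0)=0$. Put $\varphi_i(s)=s-\tau_i(s)$, $\tau_*:=\sup_{i\in\mathbb N}\tau_i(0)\in[0,+\infty]$ and $I:=\bigcup_{i=1}^{+\infty}[-\tau_i(0),0]$. Then, for every $U_0\in H$ and all $g_i\in\mathcal C(I;H)$, $i\in\mathbb N$, such that $$e^{\omega\tau_*}\sum_{i=1}^{+\infty}\int_{-\tau_*}^0\frac{1}{1-c_i}\,|k_i(\varphi_i^{-1}(z))|\,\|g_i(z)\|_H\,dz+\sum_{i=1}^{+\infty}\int_0^{+\infty}\frac{b_i}{1-c_i}\,|k_i(\varphi_i^{-1}(z))|\,dz<\frac1M,$$ there exists a unique mild solution $U$ of the problem $$\begin{cases}U'(t)=AU(t)+\sum_{i=1}^{+\infty}k_i(t)B_iU(t-\tau_i(t))+F(U(t)),& t\geq 0,\\ U(0)=U_0,\\ B_iU(s)=g_i(s),&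 s\in I,\ i\in\mathbb N,\end{cases}$$ that is, a unique $U$ satisfying $$U(t)=S(t)U_0+\int_0^tS(t-s)\Big[\sum_{i=1}^{+\infty}k_i(s)B_iU(s-\tau_i(s))+F(U(s))\Big]ds\qquad\text{for all } t\geq 0.$$
   Context: A mild solution is a continuous function $U:[0,+\infty)\to H$ satisfying the displayed integral (Duhamel) formula for all $t\ge 0$, where $B_iU(s-\tau_i(s))$ is understood as $g_i(s-\tau_i(s))$ whenever $s-\tau_i(s)\in I$ (so the initial data prescribe $B_iU$ on $I$). Since $\varphi_i'(s)=1-\tau_i'(s)\geq 1-c_i>0$, the map $\varphi_i$ is a strictly increasing bijection from $[0,+\infty)$ onto $[-\tau_i(0),+\infty)$; $\varphi_i^{-1}$ denotes its inverse. Conventions: in integrals over $(-\tau_*,0)$ the quantity $|k_i(\varphi_i^{-1}(z))|$ is taken to be $0$ for $z<-\tau_i(0)$, so that such integrals are effectively over $[-\tau_i(0),0]$; if $\tau_*=+\infty$, then $e^{\omega\tau_*}=+\infty$ and $(+\infty)\cdot 0=0$. The set $I$ is $[-\tau_*,0]$ if the supremum defining $\tau_*$ is attained, and $(-\tau_*,0]$ otherwise. $\mathcal L(H)$ is the space of bounded linear operators on $H$ with the operator norm. *)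

(* Defs.v *)
From HB Require Import structures.
From mathcomp Require Export all_boot all_order all_algebra.
From mathcomp Require Export all_classical all_reals all_analysis.

Set Implicit Arguments.
Unset Strict Implicit.
Unset Printing Implicit Defensive.

Export Order.TTheory GRing.Theory Num.Theory.
Export numFieldNormedType.Exports.

Local Open Scope classical_set_scope.
Local Open Scope ring_scope.

Section bochner.
Context {d : measure_display} {T : measurableType d} {R : realType}.
Variables (mu : {measure set T -> \bar R}) (H : normedModType R).

(* The finite sum of the v_j 1_(A_j), with mu (A_j) < +oo; the A_j need not be
   disjoint. *)
Record simple_fun := SimpleFun {
  sf_size : nat;
  sf_set : 'I_sf_size -> set T;
  sf_val : 'I_sf_size -> H;
  sf_meas : forall j, measurable (sf_set j);
  sf_fin : forall j, (mu (sf_set j) < +oo)%E }.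

Definition sf_eval (s : simple_fun) (x : T) : H :=
  \sum_(j < sf_size s) (\1_(sf_set j) x : R) *: sf_val j.

Definition sf_integral (D : set T) (s : simple_fun) : H :=
  \sum_(j < sf_size s) fine (mu (sf_set j `&` D)) *: sf_val j.

(* f is strongly mu-measurable and Bochner integrable on D, with integral v. *)
Definition is_bochner_integral (D : set T) (f : T -> H) (v : H) : Prop :=
  exists s : nat -> simple_fun,
    [/\ {ae mu, forall x, D x -> sf_eval (s n) x @[n --> \oo] --> f x},
        (\int[mu]_(x in D) (`|f x - sf_eval (s n) x|)%:E)%E @[n --> \oo]
          --> 0%E
      & sf_integral D (s n) @[n --> \oo] --> v].

End bochner.

Section operators.
Context {R : realType} {H : normedModType R}.

Definition bounded_op (f : H -> H) : Prop :=
  exists C : R, forall x, `|f x| <= C * `|x|.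

Definition opnorm (f : H -> H) : R :=
  sup [set `|f x| | x in [set x : H | `|x| <= 1]].

(* Only the S t with 0 <= t matter. *)
Definition C0_semigroup (S : R -> {linear H -> H}) : Prop :=
  [/\ forall t, 0 <= t -> bounded_op (S t),
      forall x, S 0 x = x,
      forall t s x, 0 <= t -> 0 <= s -> S (t + s) x = S t (S s x)
    & forall x, S t x @[t --> 0^'+] --> x].

(* The unbounded operator with domain DA and values A x for x in DA; A is
   irrelevant outside DA. *)
Definition is_generator (DA : set H) (A : H -> H) (S : R -> {linear H -> H})
    : Prop :=
  DA = [set x | cvg (h^-1 *: (S h x - x) @[h --> 0^'+])] /\
  forall x, DA x -> h^-1 *: (S h x - x) @[h --> 0^'+] --> A x.

End operators.

Section real_functions.
Context {R : realType}.

(* Derivative at t relative to D, one-sided at an end point of D. *)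
Definition is_derive_within (D : set R) (f : R -> R) (t l : R) : Prop :=
  (f s - f t) / (s - t) @[s --> within D t^'] --> l.

(* The library's locally_integrable requires an open domain, which rules out
   [0, +oo[. *)
Definition L1loc (D : set R) (k : R -> R) : Prop :=
  measurable_fun D k /\
  forall K, K `<=` D -> compact K ->
    (\int[@lebesgue_measure R]_(x in K) `|k x|%:E < +oo)%E.

End real_functions.

Section delays.
Context {R : realType}.
Implicit Types (tau : nat -> R -> R) (k : nat -> R -> R).

Definition phi tau (i : nat) (s : R) : R := s - tau i s.

Definition phi_inv tau (i : nat) : R -> R :=
  'pinv_(fun=> 0) `[0, +oo[ (phi tau i).

Definition tau_star tau : \bar R := ereal_sup (range (fun i => (tau i 0)%:E)).

Definition delay_set tau : set R := \bigcup_i `[- tau i 0, 0]%classic.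

(* |k_i (phi_i^-1 z)|, extended by 0 below - tau_i 0, where phi_i^-1 is
   undefined. *)
Definition abs_k_phi_inv tau k (i : nat) (z : R) : R :=
  if - tau i 0 <= z then `|k i (phi_inv tau i z)| else 0.

End delays.

Section mild.
Context {R : realType} {H : normedModType R}.
Variables (S : R -> {linear H -> H}) (tau k : nat -> R -> R).
Variables (B : nat -> {linear H -> H}) (F : H -> H).
Variables (U0 : H) (g : nat -> R -> H).

(* B_i U (s - tau_i s), read off the initial datum g_i on delay_set. If 0 <= s
   and phi_i s is not in delay_set, then 0 < phi_i s, so only the values of U
   on [0, +oo[ are used. *)
Definition delayed (U : R -> H) (i : nat) (s : R) : H :=
  if phi tau i s \in delay_set tau then g i (phi tau i s)
  else B i (U (phi tau i s)).

Definition delay_series (U : R -> H) (s : R) : nat -> H :=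
  series (fun i => k i s *: delayed U i s).

Definition mild_solution (U : R -> H) : Prop :=
  [/\ {within `[0, +oo[, continuous U},
      {ae @lebesgue_measure R, forall s, 0 <= s -> cvgn (delay_series U s)}
    & forall t, 0 <= t ->
        exists2 J : H,
          is_bochner_integral (@lebesgue_measure R) `[0, t]
            (fun s => S (t - s) (limn (delay_series U s) + F (U s))) J
          & U t = S t U0 + J].

End mild.

(* Main.v *)
Require Import Defs.
From mathcomp Require Import measurable_realfun ring lra.

(** The Duhamel map is a contraction for a weighted sup norm, for arbitrarily
    large times. Take [lambda > omega] and two inputs with
    [|V r - W r| <= K e^(lambda r)]. The semigroup bound, [phi_i s <= s] and the
    change of variables [z = phi_i s] bound the distance of the two images at
    time [t] by [q K e^(lambda t)], where [q = M kappa + M L / (lambda - omega)]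
    and [kappa] is the second sum of the smallness hypothesis. As
    [M kappa < 1], a large [lambda] makes [q < 1]. Picard iteration then
    converges pointwise, and two solutions coincide because on each [[0, t]]
    their distance is bounded by [q^n K e^(lambda r)] for all [n].

    The change of variables is only needed as an inequality: [phi_i] expands
    distances by [1 - c_i], so the preimage of [E] under [phi_i] has measure at
    most [|E| / (1 - c_i)]. Bochner integrability comes from approximating a measurable
    function with separable range by the nearest point among the first [n]
    points of a dense sequence. *)

Set Implicit Arguments.
Unset Strict Implicit.
Unset Printing Implicit Defensive.

Local Open Scope classical_set_scope.
Local Open Scope ring_scope.

(** * Strongly measurable functions *)

Section strong_measurability.
Context {d : measure_display} {T : measurableType d} {R : realType}.

(** The [k_i] are only locally integrable, so the weights of the delay terms are controlled in L1
    and not pointwise: raising [lambda] shrinks the Lipschitz part of [q] but leaves [M * kappa]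
    unchanged, which is why the second sum must itself be small. The first sum supplies a finite
    bound [G] on the contribution of the initial data, which cancel in the difference of two images.
    The delay series is known to converge only at almost every time, and [is_bochner_integral] makes
    the integrand measurable only up to a null set. Hence each function is traded for a total,
    everywhere measurable version ([phi_ext], [k_ext], [g_ext], [good_source], [shifted]), and norms
    that may fail to be measurable are integrated as suprema over simple functions. No function
    space is built: distances are pointwise bounds on [[0, t]], and the Duhamel integral is a
    relation whose values are picked by choice. Iterates need only be measurable with exponential
    growth; continuity is recovered from being a Duhamel image. *)

Definition separable_range (H : normedModType R) (f : T -> H) :=
  exists u : nat -> H, forall x e, 0 < e -> exists n, `|f x - u n| < e.

(** A Pettis-type form, required at every point and not almost everywhere; it passes to continuous
    images, pairs and pointwise limits. *)
Definition strongly_measurable (H : normedModType R) (f : T -> H) :=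
  (forall O, open O -> measurable (f @^-1` O)) /\ separable_range f.

(** On a separable range, an open set [O] is the union of the countably many balls with centre [u n]
    and radius [1 / (m + 1)] that lie in [O]. Measurable distances to fixed points therefore
    suffice. *)
Lemma strongly_measurable_dist (H : normedModType R) (f : T -> H) :
  (forall v, measurable_fun setT (fun x => `|f x - v|)) ->
  separable_range f -> strongly_measurable f.
Proof.
move=> mf [u fu]; split; last by exists u.
move=> O oO.
have -> : f @^-1` O = \bigcup_n \bigcup_m
   (if pselect (ball (u n) (m.+1%:R^-1 : R) `<=` O)
    then [set x | `|f x - u n| < m.+1%:R^-1] else set0).
  apply/seteqP; split=> [x /= Ofx|x [n _ [m _]]]; last first.
    case: pselect => // sub /= h; apply: sub.
    by rewrite -ball_normE /= distrC.
  move: oO; rewrite openE => /(_ _ Ofx) /nbhs_ballP [e /= e0 eO].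
  have e20 : 0 < e / 2 by rewrite divr_gt0.
  have [m _ hm] := near_infty_natSinv_lt (PosNum e20).
  have {hm} := hm m (leqnn _); rewrite /= => hm.
  have m0 : 0 < m.+1%:R^-1 :> R by rewrite invr_gt0.
  have [n hn] := fu x _ m0.
  exists n => //; exists m => //.
  case: pselect => //= h; exfalso; apply: h => y.
  rewrite -ball_normE /= => yu; apply: eO; rewrite -ball_normE /=.
  rewrite (_ : f x - y = (f x - u n) + (u n - y)); last by rewrite addrA subrK.
  by rewrite (le_lt_trans (ler_normD _ _))// (splitr e) ltrD// (lt_trans _ hm).
apply: bigcupT_measurable => n; apply: bigcupT_measurable => m.
case: pselect => //= _.
rewrite -[X in measurable X]setTI.
have := measurable_fun_ltr (mf (u n)) (@measurable_cst _ _ _ _ setT (m.+1%:R^-1 : R)).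
by move=> /(_ measurableT [set true]); apply.
Qed.

Lemma strongly_measurable_comp (H K : normedModType R) (f : T -> H) (h : H -> K) :
  continuous h -> strongly_measurable f -> strongly_measurable (h \o f).
Proof.
move=> ch [mf [u fu]]; split.
  by move=> O oO; rewrite comp_preimage; apply: mf; exact: open_comp.
exists (h \o u) => x e e0.
have /cvgr_distC_lt/(_ e e0) := ch (f x).
move=> /nbhs_ballP [r /= r0 rh]; have [n hn] := fu x r r0.
exists n; rewrite /= distrC; apply: rh.
by rewrite -ball_normE.
Qed.

Lemma measurable_continuous_comp (H : normedModType R) (f : T -> H) (h : H -> R) :
  continuous h -> strongly_measurable f -> measurable_fun setT (h \o f).
Proof.
move=> ch [mf _]; apply: (measurability _ (RGenOInfty.measurableE R)).
move=> _ [_ [a ->] <-]; rewrite setTI comp_preimage; apply: mf.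
by apply: open_comp => //; exact: interval_open.
Qed.

Lemma strongly_measurable_norm (H : normedModType R) (f : T -> H) v :
  strongly_measurable f -> measurable_fun setT (fun x => `|f x - v|).
Proof.
apply: (@measurable_continuous_comp _ f (fun y => `|y - v|)) => y.
by apply: cvg_norm; apply: cvgB; [exact: cvg_id|exact: cvg_cst].
Qed.

Lemma measurable_strongly_measurable (f : T -> R) :
  measurable_fun setT f -> strongly_measurable (f : T -> R^o).
Proof.
move=> mf; apply: strongly_measurable_dist.
  move=> v; apply: measurableT_comp => //.
  by apply: measurable_funB => //; exact: measurable_cst.
exists (fun n => ratr (odflt 0 (@pickle_inv rat n))) => x e e0.
have /rat_in_itvoo [q] : f x - e < f x + e by rewrite ltrD2l gtrN.
rewrite in_itv /= => /andP[h1 h2].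
exists (pickle q); rewrite pickleK_inv /= ltr_distlC; lra.
Qed.

(** The product norm is a maximum, so distances to a fixed pair are measurable. Going through
    distances matters: open sets of a nonseparable product need not be countable unions of
    rectangles. *)
Lemma strongly_measurable_pair (H K : normedModType R) (f : T -> H) (g : T -> K) :
  strongly_measurable f -> strongly_measurable g ->
  strongly_measurable (fun x => (f x, g x)).
Proof.
move=> mf mg; apply: strongly_measurable_dist.
  move=> [v w]; rewrite (_ : (fun _ => _) =
    (fun x => Num.max `|f x - v| `|g x - w|)) //.
  by apply: measurable_maxr; exact: strongly_measurable_norm.
have [_ [u fu]] := mf; have [_ [w gw]] := mg.
exists (fun n => if @pickle_inv (nat * nat)%type n is Some p then (u p.1, w p.2) else (0, 0)).
move=> x e e0; have [n hn] := fu x e e0; have [m hm] := gw x e e0.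
exists (pickle (n, m)); rewrite pickleK_inv /=.
by rewrite /Num.norm /= gt_max hn hm.
Qed.

Lemma strongly_measurable_comp2 (H K L : normedModType R) (h : H * K -> L)
    (f : T -> H) (g : T -> K) : continuous h ->
  strongly_measurable f -> strongly_measurable g ->
  strongly_measurable (fun x => h (f x, g x)).
Proof.
by move=> ch mf mg; apply: (strongly_measurable_comp ch (strongly_measurable_pair mf mg)).
Qed.

Lemma strongly_measurable_cst (H : normedModType R) (v : H) :
  strongly_measurable (fun _ : T => v).
Proof.
apply: strongly_measurable_dist; first by move=> w; exact: measurable_cst.
by exists (fun=> v) => x e e0; exists 0%N; rewrite subrr normr0.
Qed.

Lemma strongly_measurable_if (H : normedModType R) (A : T -> bool) (f g : T -> H) :
  measurable_fun setT A ->
  strongly_measurable f -> strongly_measurable g ->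
  strongly_measurable (fun x => if A x then f x else g x).
Proof.
move=> mA [mf [u fu]] [mg [w gw]].
have mAt : measurable [set x | A x].
  by rewrite -[X in measurable X]setTI; exact: (mA measurableT [set true]).
split.
  move=> O oO; rewrite (_ : _ @^-1` _ = ([set x | A x] `&` f @^-1` O) `|`
    (~` [set x | A x] `&` g @^-1` O)).
    apply: measurableU; apply: measurableI; [done|exact: mf| |exact: mg].
    exact: measurableC.
  apply/seteqP; split=> x /=; first by case: ifPn => /=; [left|right; split=> //; exact/negP].
  by case=> -[h]; [rewrite h|move/negP/negbTE: h => ->].
exists (fun n => if @pickle_inv (nat + nat)%type n is Some p then
   (match p with inl p => u p | inr p => w p end) else 0).
move=> x e e0; case: ifPn => _.
  by have [n hn] := fu x e e0; exists (pickle (inl n : nat + nat)%type); rewrite pickleK_inv.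
by have [n hn] := gw x e e0; exists (pickle (inr n : nat + nat)%type); rewrite pickleK_inv.
Qed.

(** Distances to a fixed point pass to the limit, and the dense sequences of all [f_ n] merge into
    one, indexed by coded pairs. *)
Lemma strongly_measurable_lim (H : normedModType R) (f_ : nat -> T -> H) (f : T -> H) :
  (forall n, strongly_measurable (f_ n)) -> (forall x, f_ n x @[n --> \oo] --> f x) ->
  strongly_measurable f.
Proof.
move=> mf ff; apply: strongly_measurable_dist.
  move=> v; apply: (@measurable_fun_cvg _ _ _ _ (fun n x => `|f_ n x - v|)).
  - by move=> n; exact: strongly_measurable_norm.
  - move=> x _; apply: cvg_norm; apply: cvgB; [exact: ff|exact: cvg_cst].
have /choice [u hu] n : exists u : nat -> H, forall x e, 0 < e -> exists m, `|f_ n x - u m| < e.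
  by have [_] := mf n.
exists (fun n => if @pickle_inv (nat * nat)%type n is Some p then u p.1 p.2 else 0).
move=> x e e0; have e20 : 0 < e / 2 by rewrite divr_gt0.
have /cvgr_dist_lt/(_ _ e20) [n _ /(_ n (leqnn _)) hn] := ff x.
have [m hm] := hu n x _ e20.
exists (pickle (n, m)); rewrite pickleK_inv /=.
rewrite (_ : _ - _ = (f x - f_ n x) + (f_ n x - u n m)); last by rewrite addrA subrK.
by rewrite (le_lt_trans (ler_normD _ _))// (splitr e) ltrD.
Qed.

End strong_measurability.

Lemma strongly_measurable_precomp d d' (T : measurableType d) (T' : measurableType d')
  (R : realType) (H : normedModType R) (f : T' -> H) (h : T -> T') :
  measurable_fun setT h -> strongly_measurable f -> strongly_measurable (f \o h).
Proof.
move=> mh [mf [u fu]]; split; last by exists u => x e; exact: fu.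
by move=> O oO; rewrite comp_preimage -[X in measurable X]setTI; apply: mh => //; exact: mf.
Qed.

Lemma continuous_strongly_measurable (R : realType) (H : normedModType R) (f : R -> H) :
  continuous f -> strongly_measurable f.
Proof.
move=> cf; apply: (@strongly_measurable_comp _ _ _ R^o H id f cf).
by apply: measurable_strongly_measurable; exact: measurable_id.
Qed.

(** * Bochner integral *)

Section bochner_theory.
Context {d : measure_display} {T : measurableType d} {R : realType}.
Variable mu : {measure set T -> \bar R}.

Import HBNNSimple.

Lemma ae_imply (P Q : T -> Prop) : (forall x, P x -> Q x) ->
  {ae mu, forall x, P x} -> {ae mu, forall x, Q x}.
Proof. by move=> PQ; apply: filterS. Qed.

Lemma ae_imply2 (P Q W : T -> Prop) : (forall x, P x -> Q x -> W x) ->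
  {ae mu, forall x, P x} -> {ae mu, forall x, Q x} -> {ae mu, forall x, W x}.
Proof. by move=> PQ; apply: filterS2. Qed.

(* Nothing is measurable here: the integral of a nonnegative function is
   defined as a supremum over the simple functions below it. *)
Lemma ae_le_lower_integral (D : set T) (f1 f2 : T -> \bar R) :
  (forall x, D x -> 0 <= f1 x)%E -> (forall x, D x -> 0 <= f2 x)%E ->
  {ae mu, forall x, D x -> (f1 x <= f2 x)%E} ->
  (\int[mu]_(x in D) f1 x <= \int[mu]_(x in D) f2 x)%E.
Proof.
move=> f10 f20 [N [mN N0 subN]].
rewrite !ge0_integralE//; apply: ge_ereal_sup => _ [h /= hf <-].
(* Cutting [h] off on the null set keeps its integral and puts it below [f2] at every point. *)
pose h' := proj_nnsfun h (measurableC mN).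
have -> : sintegral mu h = sintegral mu h'.
  rewrite -!integralT_nnsfun; apply: ge0_ae_eq_integral => //.
  - exact/measurable_EFinP.
  - exact/measurable_EFinP.
  - by move=> x _; rewrite lee_fin.
  - by move=> x _; rewrite lee_fin.
  exists N; split => // x /= /not_implyP[_].
  apply: contra_notP => xN; congr EFin.
  by rewrite /h' /proj_nnsfun /= mindicE mem_set//= mulr1.
apply: ereal_sup_ubound; exists h' => //= x.
rewrite /h' /proj_nnsfun /= mindicE.
have [/set_mem xN|_] := boolP (x \in ~` N); rewrite ?mulr1 ?mulr0.
  apply: (le_trans (hf x)); rewrite /patch; case: ifPn => //; rewrite inE => Dx.
  by apply: contrapT => h1; apply: xN; apply: subN => /=; apply/not_implyP.
by apply: erestrict_ge0 => y Dy; exact: f20.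
Qed.

Lemma ae_eq_lower_integral (D : set T) (f1 f2 : T -> \bar R) :
  (forall x, D x -> 0 <= f1 x)%E -> (forall x, D x -> 0 <= f2 x)%E ->
  {ae mu, forall x, D x -> f1 x = f2 x} ->
  (\int[mu]_(x in D) f1 x = \int[mu]_(x in D) f2 x)%E.
Proof.
move=> f10 f20 ff; apply/eqP; rewrite eq_le.
by apply/andP; split; apply: ae_le_lower_integral => //;
  apply: filterS ff => x h Dx; rewrite h.
Qed.

Lemma measurable_mem (A : set T) : measurable A ->
  measurable_fun setT (fun x => x \in A).
Proof.
move=> mA; apply: (measurable_fun_bool true); rewrite setTI.
by rewrite (_ : _ @^-1` _ = A)//; apply/seteqP; split=> x /=; [move/set_mem|move/mem_set].
Qed.

Section normed.
Variable H : normedModType R.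

Lemma strongly_measurable_sum (I : Type) (r : seq I) (A : I -> set T) (v : I -> H) :
  (forall i, measurable (A i)) ->
  strongly_measurable (fun x => \sum_(i <- r) (\1_(A i) x : R) *: v i).
Proof.
move=> mA; elim: r => [|i r IH].
  under eq_fun do rewrite big_nil; exact: strongly_measurable_cst.
under eq_fun do rewrite big_cons.
apply: (@strongly_measurable_comp2 _ _ _ H H H (fun p => p.1 + p.2) _ _) IH.
  exact: add_continuous.
apply: (@strongly_measurable_comp2 _ _ _ R^o H H (fun p => p.1 *: p.2) (\1_(A i) : T -> R^o) (cst (v i))).
- exact: scale_continuous.
- by apply: measurable_strongly_measurable; exact: measurable_indic.
- exact: strongly_measurable_cst.
Qed.

Lemma strongly_measurable_sf_eval (s : simple_fun mu H) :
  strongly_measurable (sf_eval s).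
Proof. by apply: strongly_measurable_sum => j; exact: sf_meas. Qed.

Lemma strongly_measurableB (f g : T -> H) : strongly_measurable f ->
  strongly_measurable g -> strongly_measurable (fun x => f x - g x).
Proof.
apply: (@strongly_measurable_comp2 _ _ _ H H H (fun p => p.1 - p.2)).
by move=> p; apply: cvgB; [exact: cvg_fst|exact: cvg_snd].
Qed.

Lemma measurable_norm (f : T -> H) : strongly_measurable f ->
  measurable_fun setT (fun x => `|f x|).
Proof.
by move=> /(strongly_measurable_norm 0); under eq_fun do rewrite subr0.
Qed.

Lemma measurable_norm_dist (f g : T -> H) D : strongly_measurable f ->
  strongly_measurable g -> measurable_fun D (fun x => `|f x - g x|%:E).
Proof.
move=> mf mg; apply/measurable_EFinP/measurable_funTS/measurable_norm.
exact: strongly_measurableB.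
Qed.

(** The sets may overlap. Instead of making them disjoint, the induction splits [D] along [A i] and
    absorbs [v i] into the constant on [D1]; this is why [a] and [D] are general. *)
Lemma norm_sum_measure_le (I : Type) (r : seq I) (A : I -> set T) (v : I -> H) :
  (forall i, measurable (A i)) -> forall (a : H) (D : set T), measurable D ->
  (mu D < +oo)%E ->
  (`|fine (mu D) *: a + \sum_(i <- r) fine (mu (A i `&` D)) *: v i|%:E <=
   \int[mu]_(x in D) `|a + \sum_(i <- r) (\1_(A i) x : R) *: v i|%:E)%E.
Proof.
move=> mA; elim: r => [|i r IH] a D mD Doo.
  rewrite big_nil addr0; under eq_integral do rewrite big_nil addr0.
  rewrite integral_cst// normrZ ger0_norm ?fine_ge0//.
  by rewrite mulrC EFinM fineK// ge0_fin_numE.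
set D1 := D `&` A i; set D2 := D `\` A i.
have mD1 : measurable D1 by exact: measurableI.
have mD2 : measurable D2 by exact: measurableD.
have fin (E F : set T) : measurable E -> measurable F -> E `<=` F -> (mu F < +oo)%E -> mu E \is a fin_num.
  move=> mE mF EF Foo; rewrite ge0_fin_numE//.
  by apply: le_lt_trans Foo; apply: le_measure; rewrite ?inE.
have D1oo : (mu D1 < +oo)%E by rewrite -ge0_fin_numE// (fin _ D)//; exact: subIsetl.
have D2oo : (mu D2 < +oo)%E by rewrite -ge0_fin_numE// (fin _ D)//; exact: subDsetl.
have split (E : set T) : measurable E -> fine (mu (E `&` D)) = fine (mu (E `&` D1)) + fine (mu (E `&` D2)).
  move=> mE; rewrite -fineD; last 2 first.
    by apply: (fin _ D1) => //; exact: measurableI.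
    by apply: (fin _ D2) => //; exact: measurableI.
  congr fine; rewrite -measureU//; [|exact: measurableI|exact: measurableI|].
    by rewrite -setIUr /D1 /D2 setUIDK.
  by rewrite /D1 /D2; apply/seteqP; split=> // x [[_ [_ ?]] [_ [_ ?]]].
have Dsplit : fine (mu D) = fine (mu D1) + fine (mu D2).
  by have := split setT measurableT; rewrite !setTI.
have iD : (\int[mu]_(x in D) `|a + \sum_(j <- i :: r) (\1_(A j) x : R) *: v j|%:E =
  \int[mu]_(x in D1) `|(a + v i) + \sum_(j <- r) (\1_(A j) x : R) *: v j|%:E +
  \int[mu]_(x in D2) `|a + \sum_(j <- r) (\1_(A j) x : R) *: v j|%:E)%E.
  have DU : D = D1 `|` D2 by rewrite /D1 /D2 setUIDK.
  rewrite {1}DU ge0_integral_setU//; last 2 first.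
  - rewrite -DU; apply/measurable_EFinP/measurable_funTS/measurable_norm.
    apply: (@strongly_measurable_comp2 _ _ _ H H H (fun p => p.1 + p.2) (cst a)).
    + exact: add_continuous.
    + exact: strongly_measurable_cst.
    + exact: strongly_measurable_sum.
  - by rewrite disj_set2E; apply/eqP/seteqP; split=> // x [[_ ?] [_ ?]].
  congr (_ + _)%E; apply: eq_integral => x; rewrite inE => -[Dx Ax].
    by rewrite big_cons indicE mem_set// scale1r addrA.
  by rewrite big_cons indicE memNset// scale0r add0r.
rewrite iD; apply: le_trans; last first.
  by apply: leeD; [exact: (IH (a + v i) D1)|exact: (IH a D2)].
rewrite -EFinD lee_fin; apply: le_trans (ler_normD _ _).
rewrite le_eqVlt; apply/orP; left; apply/eqP; congr Num.norm.
rewrite big_cons Dsplit scalerDl scalerDr.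
have -> : fine (mu (A i `&` D)) = fine (mu D1) by rewrite /D1 setIC.
have -> : \sum_(j <- r) fine (mu (A j `&` D)) *: v j =
  \sum_(j <- r) fine (mu (A j `&` D1)) *: v j + \sum_(j <- r) fine (mu (A j `&` D2)) *: v j.
  by rewrite -big_split /=; apply: eq_bigr => j _; rewrite split// scalerDl.
by rewrite [RHS]addrACA [LHS]addrA; congr (_ + _); exact: addrAC.
Qed.

(** The difference is a single finite sum over the disjoint union of the two index types, with the
    values of [s2] negated; the previous bound applies with constant 0. *)
Lemma dist_sf_integral_le (D : set T) (s1 s2 : simple_fun mu H) :
  measurable D -> (mu D < +oo)%E ->
  (`|sf_integral D s1 - sf_integral D s2|%:E <=
   \int[mu]_(x in D) `|sf_eval s1 x - sf_eval s2 x|%:E)%E.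
Proof.
move=> mD Doo.
pose I := ('I_(sf_size s1) + 'I_(sf_size s2))%type.
pose r : seq I := map inl (index_enum 'I_(sf_size s1)) ++ map inr (index_enum 'I_(sf_size s2)).
pose A (i : I) := match i with inl j => sf_set j | inr j => sf_set j end.
pose v (i : I) := match i with inl j => sf_val j | inr j => - sf_val j end.
have mA i : measurable (A i) by case: i => j; exact: sf_meas.
have := @norm_sum_measure_le I r A v mA 0 D mD Doo.
rewrite scaler0 add0r; under eq_integral do rewrite add0r.
rewrite /r big_cat !big_map /=.
have -> : \sum_(j <- index_enum 'I_(sf_size s2)) fine (mu (sf_set j `&` D)) *: - sf_val j =
  - sf_integral D s2.
  by rewrite /sf_integral -sumrN; apply: eq_bigr => j _; rewrite scalerN.
move=> /le_trans; apply; rewrite le_eqVlt; apply/orP; left; apply/eqP.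
apply: eq_integral => x _; rewrite /r big_cat !big_map /=; congr (`|_ + _|%:E).
by rewrite /sf_eval -sumrN; apply: eq_bigr => j _; rewrite scalerN.
Qed.

(** Setting both the simple functions and [f] to 0 outside [D] minus the exceptional set makes the
    convergence hold everywhere. *)
Lemma ae_lim_strongly_measurable (D : set T) (s : nat -> simple_fun mu H) (f : T -> H) :
  measurable D ->
  {ae mu, forall x, D x -> sf_eval (s n) x @[n --> \oo] --> f x} ->
  exists2 f' : T -> H, strongly_measurable f' & {ae mu, forall x, D x -> f x = f' x}.
Proof.
move=> mD [N [mN N0 subN]].
have mDN : measurable (D `\` N) by exact: measurableD.
exists (fun x => if x \in D `\` N then f x else 0); last first.
  exists N; split => // x /= /not_implyP[Dx]; apply: contra_notP => xN.
  by rewrite mem_set.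
apply: (@strongly_measurable_lim _ _ _ _ (fun n x => if x \in D `\` N then sf_eval (s n) x else 0)).
  move=> n; apply: strongly_measurable_if.
  - exact: measurable_mem.
  - exact: strongly_measurable_sf_eval.
  - exact: strongly_measurable_cst.
move=> x; case: ifPn => [/set_mem [Dx xN]|_]; last exact: cvg_cst.
by apply: contrapT => h; apply: xN; apply: subN => /=; apply/not_implyP.
Qed.

(** The tool for every comparison of Bochner integrals below: contraction, growth bound and
    continuity. It is the triangle inequality through the approximating simple functions, followed
    by the limit; additivity of the integral needs measurability, so [f1] and [f2] are first
    replaced by [f1'] and [f2']. *)
Lemma bochner_dist_le (D : set T) (f1 f2 : T -> H) (v1 v2 : H) (w : T -> \bar R) :
  measurable D -> (mu D < +oo)%E ->
  is_bochner_integral mu D f1 v1 -> is_bochner_integral mu D f2 v2 ->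
  measurable_fun D w -> (forall x, D x -> 0 <= w x)%E ->
  {ae mu, forall x, D x -> (`|f1 x - f2 x|%:E <= w x)%E} ->
  (`|v1 - v2|%:E <= \int[mu]_(x in D) w x)%E.
Proof.
move=> mD Doo [s1 [sf1 i1 I1]] [s2 [sf2 i2 I2]] mw w0 fw.
have [f1' mf1 ff1] := ae_lim_strongly_measurable mD sf1.
have [f2' mf2 ff2] := ae_lim_strongly_measurable mD sf2.
have e1 n : (\int[mu]_(x in D) `|f1 x - sf_eval (s1 n) x|%:E =
    \int[mu]_(x in D) `|f1' x - sf_eval (s1 n) x|%:E)%E.
  by apply: ae_eq_lower_integral => //; apply: filterS ff1 => x h Dx; rewrite h.
have e2 n : (\int[mu]_(x in D) `|f2 x - sf_eval (s2 n) x|%:E =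
    \int[mu]_(x in D) `|f2' x - sf_eval (s2 n) x|%:E)%E.
  by apply: ae_eq_lower_integral => //; apply: filterS ff2 => x h Dx; rewrite h.
have m1 n : measurable_fun D (fun x => `|f1' x - sf_eval (s1 n) x|%:E).
  by apply: measurable_norm_dist => //; exact: strongly_measurable_sf_eval.
have m2 n : measurable_fun D (fun x => `|f2' x - sf_eval (s2 n) x|%:E).
  by apply: measurable_norm_dist => //; exact: strongly_measurable_sf_eval.
have key n : (`|sf_integral D (s1 n) - sf_integral D (s2 n)|%:E <=
   \int[mu]_(x in D) `|f1 x - sf_eval (s1 n) x|%:E +
   (\int[mu]_(x in D) w x + \int[mu]_(x in D) `|f2 x - sf_eval (s2 n) x|%:E))%E.
  apply: (le_trans (dist_sf_integral_le _ _ mD Doo)).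
  rewrite e1 e2 -ge0_integralD// -ge0_integralD//; last 2 first.
  - by move=> x Dx; rewrite adde_ge0// w0.
  - exact: emeasurable_funD.
  apply: ae_le_lower_integral => //.
    by move=> x Dx; rewrite adde_ge0// adde_ge0// w0.
  apply: filterS3 ff1 ff2 fw => x h1 h2 h3 Dx.
  apply: le_trans; last first.
    by apply: leeD (lexx _) _; apply: leeD (h3 Dx) (lexx _).
  rewrite -!EFinD lee_fin h1// h2//.
  set a := f1' x; set b := sf_eval (s1 n) x; set p := f2' x; set q := sf_eval (s2 n) x.
  rewrite (_ : b - q = (b - a) + ((a - p) + (p - q))).
    apply: (le_trans (ler_normD _ _)); rewrite distrC lerD2l.
    exact: ler_normD.
  by rewrite [a - p + _]addrA subrK addrA subrK.
have lhs : (`|sf_integral D (s1 n) - sf_integral D (s2 n)|%:E @[n --> \oo] --> `|v1 - v2|%:E)%E.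
  by apply: cvg_EFin; [exact: nearW|apply: cvg_norm; exact: cvgB].
have rhs : ((\int[mu]_(x in D) `|f1 x - sf_eval (s1 n) x|%:E +
   (\int[mu]_(x in D) w x + \int[mu]_(x in D) `|f2 x - sf_eval (s2 n) x|%:E)) @[n --> \oo]
   --> (\int[mu]_(x in D) w x))%E.
  rewrite -[X in _ --> X]add0e -[X in _ --> (_ + X)%E]adde0.
  apply: cvgeD => //.
  by apply: cvgeD => //; [rewrite fin_num_adde_defl//|exact: cvg_cst].
rewrite -(cvg_lim _ lhs)// -(cvg_lim _ rhs)//.
apply: lee_lim; [by apply/cvg_ex; eexists; exact: lhs|by apply/cvg_ex; eexists; exact: rhs|].
exact: nearW.
Qed.

(** The new value is put on [B] intersected with [D], of finite measure because [D] is, and [B] is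
    removed from all the old sets. *)
Lemma sf_update (D B : set T) (s : simple_fun mu H) (v : H) :
  measurable D -> (mu D < +oo)%E -> measurable B ->
  exists s' : simple_fun mu H, forall x, D x ->
    sf_eval s' x = if x \in B then v else sf_eval s x.
Proof.
move=> mD Doo mB.
pose A (j : 'I_(sf_size s).+1) := if unlift ord0 j is Some k then sf_set k `\` B else B `&` D.
pose w (j : 'I_(sf_size s).+1) := if unlift ord0 j is Some k then sf_val k else v.
have mA j : measurable (A j).
  rewrite /A; case: unliftP => [k _|_]; last exact: measurableI.
  by apply: measurableD => //; exact: sf_meas.
have Aoo j : (mu (A j) < +oo)%E.
  rewrite /A; case: unliftP => [k _|_].
    apply: le_lt_trans (sf_fin k); apply: le_measure; rewrite ?inE//; last exact: sf_meas.
    by apply: measurableD => //; exact: sf_meas.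
  apply: le_lt_trans Doo; apply: le_measure; rewrite ?inE//.
  exact: measurableI.
exists (SimpleFun w mA Aoo) => x Dx; rewrite /sf_eval /= big_ord_recl.
have -> : A ord0 = B `&` D by rewrite /A unlift_none.
have -> : w ord0 = v by rewrite /w unlift_none.
rewrite (eq_bigr (fun j => (\1_(sf_set j `\` B) x : R) *: sf_val j)); last first.
  by move=> j _; rewrite /A /w liftK.
case: ifPn => xB.
  rewrite indicE mem_set; last by split=> //; exact/set_mem.
  rewrite scale1r big1 ?addr0// => j _.
  by rewrite indicE memNset ?scale0r//= => -[_]; apply; exact/set_mem.
rewrite indicE memNset; last by move=> [/mem_set]; rewrite (negbTE xB).
rewrite scale0r add0r; apply: eq_bigr => j _; congr (_ *: _).
rewrite !indicE in_setD xB andbT; done.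
Qed.

(** Step [n] switches the value to [u n] exactly where this is strictly closer to [f], so the error
    never increases. *)
Lemma sf_approx (D : set T) (f : T -> H) : measurable D -> (mu D < +oo)%E ->
  strongly_measurable f ->
  exists s : nat -> simple_fun mu H,
    (forall x, D x -> sf_eval (s n) x @[n --> \oo] --> f x) /\
    (forall n x, D x -> `|f x - sf_eval (s n) x| <= `|f x|).
Proof.
move=> mD Doo mf; have [_ [u fu]] := mf.
pose B (s : simple_fun mu H) n := [set x | `|f x - u n| < `|f x - sf_eval s x|].
have mB s n : measurable (B s n).
  rewrite -[X in measurable X]setTI.
  have := measurable_fun_ltr (strongly_measurable_norm (u n) mf)
    (measurable_norm (strongly_measurableB mf (strongly_measurable_sf_eval s))).
  by move=> /(_ measurableT [set true]); exact.
have /choice [up upE] (p : simple_fun mu H * nat) : exists s' : simple_fun mu H, forall x, D x ->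
    sf_eval s' x = if x \in B p.1 p.2 then u p.2 else sf_eval p.1 x.
  by apply: sf_update.
(* Starting from the zero function keeps every error below [|f x|], the dominating function used for
   [bochner_exists]. *)
pose s0 : simple_fun mu H := @SimpleFun _ _ _ _ _ 0 (fun=> set0) (fun=> 0)
   (fun=> measurable0) (fun _ => eq_ind_r (fun z => (z < +oo)%E) (ltry 0) (measure0 mu)).
pose s := fix s n := if n is n'.+1 then up (s n', n') else s0.
have sS n x : D x -> `|f x - sf_eval (s n.+1) x| <= `|f x - sf_eval (s n) x| /\
    `|f x - sf_eval (s n.+1) x| <= `|f x - u n|.
  move=> Dx; rewrite /= upE//=; case: ifPn => [/set_mem|/negP]; rewrite ?inE /B /= => h; split=> //.
  - exact: ltW.
  - by rewrite leNgt; apply/negP.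
have mono x : D x -> forall n m, (n <= m)%N -> `|f x - sf_eval (s m) x| <= `|f x - sf_eval (s n) x|.
  move=> Dx n m nm; rewrite -(subnK nm); elim: (m - n)%N => // k IH.
  by apply: le_trans IH; have [] := sS (k + n)%N x Dx.
exists s; split.
  move=> x Dx; apply/cvgrPdist_lt => e e0; have [n hn] := fu x e e0.
  exists n.+1 => // m /= nm; apply: le_lt_trans (mono x Dx _ _ nm) _.
  by apply: le_lt_trans hn; have [] := sS n x Dx.
move=> n x Dx; apply: le_trans (mono x Dx 0%N n (leq0n _)) _.
by rewrite /= /sf_eval big_ord0 subr0.
Qed.

Definition sf_restrict (D : set T) (mD : measurable D) (s : simple_fun mu H) : simple_fun mu H.
Proof.
refine (@SimpleFun _ _ _ _ _ (sf_size s) (fun j => sf_set j `&` D) (fun j => sf_val j) _ _).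
  by move=> j; apply: measurableI => //; exact: sf_meas.
move=> j; apply: le_lt_trans (sf_fin j); apply: le_measure; rewrite ?inE.
- by apply: measurableI => //; exact: sf_meas.
- exact: sf_meas.
- exact: subIsetl.
Defined.

(** Brings integrals over different intervals to a common domain, where their integrands can be
    compared. *)
Lemma bochner_widen (D E : set T) (f : T -> H) (v : H) :
  measurable D -> D `<=` E ->
  is_bochner_integral mu D f v ->
  is_bochner_integral mu E (fun x => if x \in D then f x else 0) v.
Proof.
move=> mD DE [s [sf si sI]]; exists (fun n => sf_restrict mD (s n)).
have ev n x : sf_eval (sf_restrict mD (s n)) x = if x \in D then sf_eval (s n) x else 0.
  rewrite /sf_eval /=; case: ifPn => xD.
    by apply: eq_bigr => j _; rewrite !indicE in_setI xD andbT.
  by rewrite big1 // => j _; rewrite indicE in_setI (negbTE xD) andbF scale0r.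
split.
- apply: filterS sf => x h Ex; under eq_fun do rewrite ev.
  by case: ifPn => [/set_mem/h//|_]; exact: cvg_cst.
- rewrite (_ : (fun n => _) = (fun n => \int[mu]_(x in D) `|f x - sf_eval (s n) x|%:E)%E) //.
  apply/funext => n; rewrite -[in RHS](setIidr DE) integral_mkcondr.
  apply: eq_integral => x _; rewrite ev /patch; case: ifPn => // _.
  by rewrite subrr normr0.
- rewrite (_ : (fun n => _) = (fun n => sf_integral D (s n))) //.
  apply/funext => n; rewrite /sf_integral /=; apply: eq_bigr => j _.
  by rewrite -setIA (setIidl DE).
Qed.

End normed.

(** Dominated convergence sends the L1 errors of the approximants to 0. Their integrals are then
    Cauchy, and completeness of [H] gives the value. *)
Lemma bochner_exists (H : completeNormedModType R) (D : set T) (f f' : T -> H) :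
  measurable D -> (mu D < +oo)%E -> strongly_measurable f' ->
  {ae mu, forall x, D x -> f x = f' x} ->
  (\int[mu]_(x in D) `|f' x|%:E < +oo)%E ->
  exists v, is_bochner_integral mu D f v.
Proof.
move=> mD Doo mf ff foo.
have [s [sf sle]] := sf_approx mD Doo mf.
have ms n : strongly_measurable (sf_eval (s n)) by exact: strongly_measurable_sf_eval.
have e1 n : (\int[mu]_(x in D) `|f x - sf_eval (s n) x|%:E =
    \int[mu]_(x in D) `|f' x - sf_eval (s n) x|%:E)%E.
  by apply: ae_eq_lower_integral => //; apply: filterS ff => x h Dx; rewrite h.
have I0 : (\int[mu]_(x in D) `|f' x - sf_eval (s n) x|%:E @[n --> \oo] --> 0)%E.
  have [|||||_ _] := @dominated_convergence _ _ _ mu D mD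
    (fun n x => `|f' x - sf_eval (s n) x|%:E) (cst 0%E) (fun x => `|f' x|%:E).
  - by move=> n; exact: measurable_norm_dist.
  - exact: measurable_cst.
  - apply: aeW => x Dx; apply: cvg_EFin; first exact: nearW.
    rewrite -(normr0 H) -(subrr (f' x)); apply: cvg_norm; apply: cvgB; first exact: cvg_cst.
    exact: sf.
  - apply/integrableP; split.
      exact/measurable_EFinP/measurable_funTS/measurable_norm.
    by under eq_integral do rewrite /= normr_id.
  - by apply: aeW => x n Dx; rewrite /= normr_id lee_fin; exact: sle.
  by rewrite integral0.
have /fine_cvgP[finI cvI] := I0.
suff /cvg_ex [v Iv] : cvg (sf_integral D (s n) @[n --> \oo]).
  exists v; exists s; split => //.
    by apply: filterS ff => x h Dx; rewrite h//; exact: sf.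
  by rewrite (_ : (fun n => _) = (fun n => \int[mu]_(x in D) `|f' x - sf_eval (s n) x|%:E)%E)//; apply/funext.
apply: cauchy_cvg; apply: cauchy_exP => e e0.
have e20 : 0 < e / 2 by rewrite divr_gt0.
have /cvgr_lt/(_ (e / 2) e20) cvI2 := cvI.
have [N _ hN] : \forall n \near \oo, (\int[mu]_(x in D) `|f' x - sf_eval (s n) x|%:E < (e / 2)%:E)%E.
  by apply: filterS2 finI cvI2 => n h1 h2; rewrite -(fineK h1) lte_fin.
exists (sf_integral D (s N)); exists N => // m /= Nm.
rewrite -ball_normE /= -lte_fin.
apply: le_lt_trans (dist_sf_integral_le _ _ mD Doo) _.
apply: (@le_lt_trans _ _ (\int[mu]_(x in D) `|f' x - sf_eval (s N) x|%:E +
   \int[mu]_(x in D) `|f' x - sf_eval (s m) x|%:E)%E); last first.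
  by rewrite (splitr e) EFinD; apply: lteD; apply: hN => /=.
rewrite -ge0_integralD//; [|exact: measurable_norm_dist|exact: measurable_norm_dist].
apply: ge0_le_integral => //.
- exact: measurable_norm_dist.
- by apply: emeasurable_funD; exact: measurable_norm_dist.
move=> x Dx; rewrite -EFinD lee_fin (distrC (f' x)).
rewrite (_ : _ - _ = (sf_eval (s N) x - f' x) + (f' x - sf_eval (s m) x)); last by rewrite addrA subrK.
exact: ler_normD.
Qed.

End bochner_theory.

(** * Preimages under expanding maps *)

Section expanding.
Context {R : realType}.
Local Notation mu := (@lebesgue_measure R).
Variables (f : R -> R) (a : R).
Hypothesis a0 : 0 < a.
Hypothesis f_exp : forall x y, x <= y -> a * (y - x) <= f y - f x.
Hypothesis mf : measurable_fun setT f.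

Let mpre E : measurable E -> measurable (f @^-1` E).
Proof. by move=> mE; rewrite -[X in measurable X]setTI; exact: mf. Qed.

(** Two points of the preimage are at most [(q - p) / a] apart, so the preimage fits in the interval
    from its infimum to its supremum. *)
Let preimage_ocitv (p q : R) : p < q ->
  (a%:E * mu (f @^-1` `]p, q]) <= (q - p)%:E)%E.
Proof.
move=> pq; set P := f @^-1` _.
have mP : measurable P by apply: mpre.
have [->|/set0P[x0 Px0]] := eqVneq P set0.
  by rewrite measure0 mule0 lee_fin subr_ge0 ltW.
pose l := (q - p) / a.
have Pl x y : P x -> P y -> y <= x + l.
  rewrite /P /= !in_itv /= => /andP[h1 h2] /andP[h3 h4].
  have l0 : 0 <= l by rewrite divr_ge0 ?subr_ge0 ?ltW.
  have [xy|yx] := leP x y; last by rewrite (le_trans (ltW yx))// lerDl.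
  rewrite -lerBlDl /l ler_pdivlMr// mulrC.
  by apply: (le_trans (f_exp xy)); lra.
have ubP : has_sup P by split; [exists x0|exists (x0 + l) => y Py; exact: Pl].
have lbP : has_inf P.
  by split; [exists x0|exists (x0 - l) => y Py; rewrite lerBlDr; exact: Pl].
have il : sup P - inf P <= l.
  rewrite lerBlDl -lerBlDr; apply: lb_le_inf; first by exists x0.
  move=> x Px; rewrite lerBlDr; apply: ge_sup; first by exists x0.
  by move=> y Py; exact: Pl.
have sub : P `<=` `[inf P, sup P]%classic.
  move=> x Px /=; rewrite in_itv /=; apply/andP; split.
    by apply: ge_inf => //; exact: lbP.2.
  by apply: ub_le_sup => //; exact: ubP.2.
apply: (@le_trans _ _ (a%:E * mu `[inf P, sup P])%E).
  apply: lee_wpmul2l; first by rewrite lee_fin ltW.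
  by apply: le_measure; rewrite ?inE//; exact: measurable_itv.
rewrite lebesgue_measure_itv /=; case: ifPn => _.
  rewrite -EFinB -EFinM lee_fin mulrC -ler_pdivlMr//.
by rewrite mule0 lee_fin subr_ge0 ltW.
Qed.

(** Lebesgue measure is unfolded as an infimum over countable covers by half-open intervals; each
    cover of [E] pulls back to a cover of the preimage, and the interval case applies termwise. *)
Lemma expanding_preimage_le (E : set R) : measurable E ->
  (a%:E * mu (f @^-1` E) <= mu E)%E.
Proof.
move=> mE; rewrite [leRHS]/lebesgue_measure /lebesgue_stieltjes_measure.
rewrite /measure_extension /mu_ext; apply: le_ereal_inf_tmp => _ [A [mA EA] <-].
have mA' k : measurable (A k : set R).
  by have [x _ <-] := mA k; exact: measurable_itv.
apply: (@le_trans _ _ (a%:E * \sum_(k <oo) mu (f @^-1` A k))%E).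
  apply: lee_wpmul2l; first by rewrite lee_fin ltW.
  apply: measure_sigma_subadditive.
  - by move=> k; exact: mpre.
  - exact: mpre.
  - by rewrite -preimage_bigcup; exact: preimage_subset.
rewrite -nneseriesZl//; apply: lee_nneseries => k _.
  by rewrite mule_ge0// lee_fin ltW.
have /ocitvP[->|[[p q] /= pq ->]] := mA k.
  by rewrite preimage_set0 measure0 mule0.
apply: (le_trans (preimage_ocitv pq)).
by rewrite wlength_itv_bnd// ltW.
Qed.

(** The left side is the integral of [h] against the pushforward of Lebesgue measure by [f], a
    measure dominated by [a^-1] times Lebesgue measure. *)
Lemma expanding_integral_le (h : R -> \bar R) : measurable_fun setT h ->
  (forall x, 0 <= h x)%E ->
  (\int[mu]_x h (f x) <= a^-1%:E * \int[mu]_x h x)%E.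
Proof.
move=> mh h0.
have ai0 : 0 <= a^-1 by rewrite invr_ge0 ltW.
have mf' : measurable_fun (setT : set (measurableTypeR R)) (f : _ -> measurableTypeR R) := mf.
have mh' : measurable_fun (setT : set (measurableTypeR R)) h := mh.
pose m1 := measure_function_pushforward__canonical__measure_function_Measure mu mf'.
have -> : (\int[mu]_x h (f x) = \int[m1]_x h x)%E.
  by rewrite (ge0_integral_pushforward mf').
rewrite -(@ge0_integral_mscale _ _ _ mu setT measurableT (NngNum ai0) h)//.
apply: ge0_le_measure_integral => // S mS.
rewrite /pushforward /mscale /=.
apply: (@le_trans _ _ (a^-1%:E * (a%:E * mu (f @^-1` S)))%E).
  by rewrite muleA -EFinM mulVf ?mul1e// gt_eqF.
by apply: lee_wpmul2l; [rewrite lee_fin|exact: expanding_preimage_le].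
Qed.

End expanding.

(** * Bounded operators and semigroups *)

Lemma cvg_dist_squeeze (R : realType) (T : Type) (F : set_system T) (K : normedModType R)
    (f : T -> K) (l : K) (h : T -> R) : Filter F ->
  (\forall x \near F, `|f x - l| <= h x) -> h x @[x --> F] --> (0 : R) ->
  f x @[x --> F] --> l.
Proof.
move=> FF fh h0; apply/cvgrPdist_lt => e e0.
have /cvgr_lt/(_ e e0) he := h0.
by apply: filterS2 fh he => x h1 h2; rewrite distrC (le_lt_trans h1).
Qed.

Lemma continuous_maxr_cst (R : realType) (a : R) : continuous (fun r : R => Num.max r a).
Proof.
move=> x; apply/(@cvgrPdist_lt _ R^o) => e e0; apply/nbhs_ballP; exists e => //= y.
rewrite /ball_ /= => xy; apply: le_lt_trans xy; rewrite ler_norml.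
have := ler_norm (y - x); have := ler_norm (x - y); rewrite [`|y - x|]distrC.
by case: (leP y a) => ?; case: (leP x a) => ?; lra.
Qed.

Lemma continuous_minr_cst (R : realType) (a : R) : continuous (fun r : R => Num.min r a).
Proof.
move=> x; apply/(@cvgrPdist_lt _ R^o) => e e0; apply/nbhs_ballP; exists e => //= y.
rewrite /ball_ /= => xy; apply: le_lt_trans xy; rewrite ler_norml.
have := ler_norm (y - x); have := ler_norm (x - y); rewrite [`|y - x|]distrC.
by case: (leP y a) => ?; case: (leP x a) => ?; lra.
Qed.

Section operators_theory.
Context {R : realType} {H : normedModType R}.

Lemma opnorm_has_ubound (f : H -> H) : bounded_op f ->
  has_ubound [set `|f x| | x in [set x : H | `|x| <= 1]].
Proof.
move=> [C fC]; exists `|C| => _ [x /= x1 <-].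
apply: (le_trans (fC x)); apply: (@le_trans _ _ (`|C| * `|x|)).
  by apply: ler_wpM2r => //; exact: ler_norm.
by rewrite -[leRHS]mulr1 ler_wpM2l.
Qed.

Lemma opnorm_ge0 (f : H -> H) : bounded_op f -> 0 <= opnorm f.
Proof.
move=> bf; apply: (@le_trans _ _ `|f 0|) => //.
by apply: ub_le_sup; [exact: opnorm_has_ubound|exists 0 => //=; rewrite normr0].
Qed.

Lemma le_opnorm (f : {linear H -> H}) x : bounded_op f -> `|f x| <= opnorm f * `|x|.
Proof.
move=> bf; have [->|x0] := eqVneq x 0; first by rewrite linear0 !normr0 mulr0.
have nx : 0 < `|x| by rewrite normr_gt0.
rewrite -ler_pdivrMr// mulrC -[X in X * _ <= _]ger0_norm ?invr_ge0// -normrZ -linearZ.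
apply: ub_le_sup; first exact: opnorm_has_ubound.
exists (`|x|^-1 *: x) => //=.
by rewrite normrZ ger0_norm ?invr_ge0// mulVf// gt_eqF.
Qed.

Lemma bounded_op_continuous (f : {linear H -> H}) : bounded_op f -> continuous f.
Proof.
move=> bf x; apply: (@cvg_dist_squeeze _ _ _ _ _ _ (fun y => opnorm f * `|y - x|)).
  by apply: nearW => y; rewrite -linearB; exact: le_opnorm.
rewrite -(mulr0 (opnorm f)) -(normr0 H) -(subrr x); apply: cvgMr; apply: cvg_norm.
by apply: cvgB; [exact: cvg_id|exact: cvg_cst].
Qed.

Variables (S : R -> {linear H -> H}) (M omega : R).
Hypothesis HS : C0_semigroup S.
Hypothesis HSbound : forall t : R, 0 <= t -> opnorm (S t) <= M * expR (omega * t).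
Hypothesis Homega : 0 < omega.
Hypothesis HM : 0 < M.

Lemma semigroup_bound t x : 0 <= t -> `|S t x| <= M * expR (omega * t) * `|x|.
Proof.
move=> t0; have [bS _ _ _] := HS; apply: le_trans (le_opnorm x (bS _ t0)) _.
by apply: ler_wpM2r => //; exact: HSbound.
Qed.

(** Factoring the smaller time out of both orbits leaves an increment near time 0. When [p < q] the
    factor found is [expR (omega * p)], which is smaller still. This turns right continuity at 0
    into two-sided continuity. *)
Lemma semigroup_dist p q x : 0 <= p -> 0 <= q ->
  `|S p x - S q x| <= M * expR (omega * q) * `|S `|p - q| x - x|.
Proof.
move=> p0 q0; have [_ _ SD _] := HS.
have [qp|pq] := leP q p.
  rewrite ger0_norm ?subr_ge0//.
  have -> : S p x = S q (S (p - q) x) by rewrite -SD ?subr_ge0// addrC subrK.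
  by rewrite -linearB; exact: semigroup_bound.
rewrite distrC ler0_norm ?subr_le0 ?(ltW pq)// opprB.
have -> : S q x = S p (S (q - p) x).
  have qp0 : 0 <= q - p by rewrite subr_ge0 ltW.
  by rewrite -(SD _ _ _ p0 qp0) [in RHS]addrC subrK.
rewrite -linearB. apply: le_trans (semigroup_bound _ p0) _.
by apply: ler_wpM2r => //; rewrite ler_pM2l// ler_expR ler_pM2l// ltW.
Qed.

Lemma semigroup_cvg0 x : S `|r| x @[r --> (0 : R)] --> x.
Proof.
have [_ S0 _ cS] := HS.
apply/cvgrPdist_lt => e e0; have /cvgrPdist_lt/(_ e e0) := cS x.
rewrite near_withinE => /nbhs_ballP [r /= r0 h].
apply/nbhs_ballP; exists r => //= y; rewrite /ball_ /= sub0r normrN => yr.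
have [->|y0] := eqVneq y 0; first by rewrite normr0 S0 subrr normr0.
apply: h; last by rewrite /= normr_gt0.
by rewrite -(@ball_normE R R^o) /= sub0r normrN normr_id.
Qed.

(** Joint continuity in time and vector, from the splitting [S p (y - y0) + (S p y0 - S q0 y0)].
    Clamping the time at 0 gives a total function, as [S] is controlled at nonnegative times
    only. *)
Lemma semigroup_continuous :
  continuous (fun p : R^o * H => S (Num.max p.1 0) p.2).
Proof.
move=> [p0 y0] /=; set q0 := Num.max p0 0.
have mge (p : R) : 0 <= Num.max p 0 by rewrite le_max lexx orbT.
apply: (@cvg_dist_squeeze _ _ _ _ _ _ (fun p : R^o * H =>
   M * expR (omega * Num.max p.1 0) * `|p.2 - y0| +
   M * expR (omega * q0) * `|S `|Num.max p.1 0 - q0| y0 - y0|)).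
  apply: nearW => -[p y] /=.
  rewrite (_ : _ - _ = S (Num.max p 0) (y - y0) + (S (Num.max p 0) y0 - S q0 y0)).
    apply: le_trans (ler_normD _ _) _; apply: lerD; first exact: (semigroup_bound _ (mge p)).
    exact: (semigroup_dist _ (mge p) (mge p0)).
  by rewrite linearB /= addrA subrK.
have cm : (Num.max p.1 0 : R) @[p --> (p0, y0)] --> q0.
  apply: (@cvg_comp _ _ _ (fun p : R^o * H => p.1 : R^o) (fun r : R => Num.max r 0)).
    exact: cvg_fst.
  exact: continuous_maxr_cst.
rewrite -[X in _ --> X](addr0 0); apply: cvgD.
  rewrite -[X in _ --> X](mulr0 (M * expR (omega * q0))); apply: cvgM.
    apply: cvgMr; apply: (@continuous_cvg _ _ _ _ _ _ expR); first exact: continuous_expR.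
    exact: cvgMr.
  rewrite -[X in _ --> X](normr0 H) -(subrr y0); apply: cvg_norm; apply: cvgB; last exact: cvg_cst.
  exact: cvg_snd.
rewrite -[X in _ --> X](mulr0 (M * expR (omega * q0))); apply: cvgMr.
rewrite -[X in _ --> X](normr0 H) -(subrr y0); apply: cvg_norm; apply: cvgB; last exact: cvg_cst.
have c0 : (Num.max p.1 0 - q0 : R) @[p --> (p0, y0)] --> (0 : R).
  by rewrite -[X in _ --> X](subrr q0); apply: cvgB => //; exact: cvg_cst.
exact: (cvg_comp _ _ c0 (@semigroup_cvg0 y0)).
Qed.

Lemma semigroup_cvg (T : Type) (A : set_system T) (u : T -> R) (p : R) (y : H) :
  Filter A -> u x @[x --> A] --> p ->
  S (Num.max (u x) 0) y @[x --> A] --> S (Num.max p 0) y.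
Proof.
move=> FA up.
have c : (u x : R^o, y) @[x --> A] --> (p : R^o, y).
  exact: (@cvg_pair _ _ _ A (nbhs (p : R^o)) (nbhs y) _ _ _ u (cst y) up (cvg_cst y)).
exact: (cvg_comp _ _ c (@semigroup_continuous (p : R^o, y))).
Qed.

End operators_theory.

(** * Delays *)

Lemma is_derive_within_continuous (R : realType) (D : set R) (f : R -> R) (t l : R) :
  is_derive_within D f t l -> f s @[s --> within D (nbhs t)] --> f t.
Proof.
move=> fl; apply/(@cvgrPdist_lt _ R^o) => e e0.
have /(@cvgrPdist_lt _ R^o)/(_ 1 ltr01) hl := fl.
rewrite near_withinE /dnbhs near_withinE in hl; have /nbhs_ballP [r /= r0 h] := hl.
have le0 : 0 < `|l| + 2 by rewrite ltr_wpDl.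
have r20 : 0 < e / (`|l| + 2) by rewrite divr_gt0.
rewrite near_withinE; apply/nbhs_ballP.
exists (Num.min r (e / (`|l| + 2))); first by rewrite /= lt_min r0.
move=> s; rewrite -(@ball_normE R R^o) /= lt_min => /andP[sr sr2] Ds.
have [->|st] := eqVneq s t; first by rewrite subrr normr0.
have := h s _ st Ds; rewrite -(@ball_normE R R^o) /= => /(_ sr) hq.
have st0 : s - t != 0 by rewrite subr_eq0.
have -> : f t - f s = (l - (f s - f t) / (s - t) - l) * (s - t) by field.
rewrite normrM distrC.
apply: (@le_lt_trans _ _ ((`|l| + 2) * `|s - t|)).
  apply: ler_wpM2r => //; rewrite distrC.
  by apply: (le_trans (ler_normB _ _)); rewrite addrC lerD2l; lra.
by rewrite mulrC -ltr_pdivlMr// distrC.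
Qed.

Lemma is_derive_within_interior (R : realType) (f : R -> R) (t l : R) : 0 < t ->
  is_derive_within `[0, +oo[ f t l -> is_derive t 1 f l.
Proof.
move=> t0 fl.
have cv : h^-1 *: ((f \o shift t) h - f t) @[h --> 0^'] --> l.
  apply/(@cvgrPdist_lt _ R^o) => e e0.
  have /(@cvgrPdist_lt _ R^o)/(_ e e0) hl := fl.
  rewrite near_withinE /dnbhs near_withinE in hl; have /nbhs_ballP [r /= r0 h] := hl.
  rewrite /dnbhs near_withinE.
  apply/nbhs_ballP; exists (Num.min r t); first by rewrite /= lt_min r0.
  move=> s; rewrite -(@ball_normE R R^o) /= sub0r normrN lt_min => /andP[sr st] s0.
  have := h (s + t); rewrite -(@ball_normE R R^o) /= addrK.
  rewrite opprD addrCA subrr addr0 normrN => /(_ sr); rewrite mulrC; apply.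
    by rewrite -subr_eq0 addrK.
  rewrite in_itv /= andbT -lerBlDr sub0r.
  by move: st; rewrite ltr_norml => /andP[/ltW].
apply: DeriveDef.
  by apply/cvg_ex; exists l; rewrite /= ; under eq_fun do rewrite [_%:A]mulr1.
by apply/cvg_lim => //; under eq_fun do rewrite [_%:A]mulr1.
Qed.

Section delay_theory.
Context {R : realType}.
Local Notation mu := (@lebesgue_measure R).
Variables (tau : nat -> R -> R) (c : nat -> R).
Hypothesis Htau_ge0 : forall (i : nat) (t : R), 0 <= t -> 0 <= tau i t.
Hypothesis Htau_diff : forall (i : nat) (t : R), 0 <= t ->
  exists2 l : R, is_derive_within `[0, +oo[ (tau i) t l & l <= c i.
Hypothesis Hc : forall i : nat, c i < 1.

Lemma tau_continuous i (a b : R) : 0 <= a -> {within `[a, b], continuous (tau i)}.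
Proof.
move=> a0; apply/subspace_continuousP => x /=; rewrite in_itv /= => /andP[ax xb].
have [l /is_derive_within_continuous h _] := Htau_diff i (le_trans a0 ax).
apply: cvg_trans h; apply: cvg_app => P /=; rewrite !nbhs_nearE !near_withinE.
apply: filterS => y h; rewrite /= in_itv /= => /andP[ay yb].
by apply: h; rewrite /= in_itv /= andbT (le_trans a0).
Qed.

Lemma phi_expanding i (x y : R) : 0 <= x -> x <= y ->
  (1 - c i) * (y - x) <= phi tau i y - phi tau i x.
Proof.
move=> x0; rewrite le_eqVlt => /predU1P[->|xy]; first by rewrite !subrr mulr0.
(* The mean value theorem takes the derivative as a function; negative times get the dummy value
   0. *)
have /choice [dt hdt] t : exists l, 0 <= t -> is_derive_within `[0, +oo[ (tau i) t l /\ l <= c i.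
  by have [/(Htau_diff i)[l h1 h2]|h] := leP 0 t; [exists l|exists 0].
have [||z zxy hz] := @MVT R (tau i) dt x y xy.
- move=> z; rewrite in_itv /= => /andP[xz zy].
  have z0 : 0 < z by exact: le_lt_trans xz.
  by apply: is_derive_within_interior => //; have [] := hdt z (ltW z0).
- exact: tau_continuous.
have z0 : 0 <= z by move: zxy; rewrite in_itv /= => /andP[xz _]; lra.
have [_ dz] := hdt z z0.
have : dt z * (y - x) <= c i * (y - x) by rewrite ler_wpM2r// subr_ge0 ltW.
rewrite /phi -hz; lra.
Qed.

(* The slope on the negative half-line keeps the extension expanding. *)
Definition phi_ext i (s : R) : R :=
  if 0 <= s then phi tau i s else - tau i 0 + (1 - c i) * s.

Lemma phi_ext_expanding i (x y : R) : x <= y ->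
  (1 - c i) * (y - x) <= phi_ext i y - phi_ext i x.
Proof.
rewrite /phi_ext => xy; have [x0|x0] := leP 0 x.
  by rewrite (le_trans x0 xy); exact: phi_expanding.
have [y0|y0] := leP 0 y; last by lra.
have := phi_expanding i (lexx 0) y0; rewrite /phi; lra.
Qed.

Let c1 i : 0 < 1 - c i. Proof. by rewrite subr_gt0. Qed.

Lemma phi_ge i s : 0 <= s -> - tau i 0 <= phi tau i s.
Proof.
move=> s0; have := phi_expanding i (lexx 0) s0; rewrite /phi !subr0.
have : 0 <= (1 - c i) * s by rewrite mulr_ge0// ltW.
lra.
Qed.

Lemma phi_ext_measurable i : measurable_fun setT (phi_ext i).
Proof.
apply: nondecreasing_measurable => // x y xy; rewrite -subr_ge0.
by apply: le_trans (phi_ext_expanding i xy); rewrite mulr_ge0 ?subr_ge0// ltW.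
Qed.

Lemma phi_injective i : {in `[0, +oo[%classic &, injective (phi tau i)}.
Proof.
move=> x y; rewrite !inE /= !in_itv /= !andbT => x0 y0 e.
wlog xy : x y x0 y0 e / x <= y.
  by move=> h; have [/h|/ltW/h h'] := leP x y; [exact|exact/esym/h'].
have := phi_expanding i x0 xy; rewrite e subrr => h.
have : y - x <= 0 by rewrite -(pmulr_rle0 _ (c1 i)).
by rewrite subr_le0 => yx; apply/eqP; rewrite eq_le xy.
Qed.

Lemma phi_invK i (s : R) : 0 <= s -> phi_inv tau i (phi tau i s) = s.
Proof.
move=> s0; rewrite /phi_inv; apply: (@pinvKV _ _ _ `[0, +oo[%classic (phi tau i)).
  exact: phi_injective.
by rewrite inE /= in_itv /= andbT.
Qed.

Lemma phi_surjective i (z : R) : - tau i 0 <= z ->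
  exists2 s, 0 <= s & phi tau i s = z.
Proof.
(* At [b] the expansion estimate from time 0 already forces [phi tau i b >= z], so the intermediate
   value theorem applies on [[0, b]]. *)
move=> tz; pose b := (z + tau i 0) / (1 - c i).
have b0 : 0 <= b by apply: divr_ge0; [lra|exact: ltW].
have hb := phi_expanding i (lexx 0) b0.
have zb : z <= phi tau i b.
  have : (1 - c i) * (b - 0) = z + tau i 0 by rewrite subr0 /b mulrC divfK// gt_eqF.
  by move: hb; rewrite /phi; lra.
have p0 : phi tau i 0 = - tau i 0 by rewrite /phi sub0r.
have [||s] := @IVT R (phi tau i) 0 b z b0.
- apply/subspace_continuousP => x xb; apply: cvgB; first exact: cvg_within.
  have /subspace_continuousP := @tau_continuous i 0 b (lexx 0); exact.
- by rewrite p0 ge_min tz/= le_max zb orbT.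
by rewrite in_itv /= => /andP[s0 _] <-; exists s.
Qed.

Lemma phi_invE i (z : R) : - tau i 0 <= z ->
  0 <= phi_inv tau i z /\ phi tau i (phi_inv tau i z) = z.
Proof. by move=> /phi_surjective[s s0 <-]; rewrite phi_invK. Qed.

(** * Change of variables in the delay coefficients *)

Variable k : nat -> R -> R.
Hypothesis Hk : forall i : nat, L1loc `[0, +oo[ (k i).

Definition k_ext i := k i \_ `[0, +oo[.

Lemma k_extE i s : 0 <= s -> k_ext i s = k i s.
Proof. by move=> s0; rewrite /k_ext patchE mem_set//= in_itv /= s0. Qed.

Lemma k_ext0 i s : s < 0 -> k_ext i s = 0.
Proof. by move=> s0; rewrite /k_ext patchE memNset//= in_itv /= andbT leNgt s0. Qed.

Lemma k_ext_measurable i : measurable_fun setT (k_ext i).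
Proof.
have [mk _] := Hk i.
by apply/(measurable_restrictT _ _).1; [exact: measurable_itv|exact: mk].
Qed.

(** The inverse of an expanding map is nondecreasing. Clamping its argument at [- tau i 0] makes it
    monotone on the whole line, hence measurable. *)
Lemma abs_k_phi_inv_measurable i : measurable_fun setT (abs_k_phi_inv tau k i).
Proof.
pose psi z := phi_inv tau i (Num.max z (- tau i 0)).
have mpsi : measurable_fun setT psi.
  apply: nondecreasing_measurable => // x y xy; rewrite /psi.
  have hx : - tau i 0 <= Num.max x (- tau i 0) by rewrite le_max lexx orbT.
  have hy : - tau i 0 <= Num.max y (- tau i 0) by rewrite le_max lexx orbT.
  have [p0 pE] := phi_invE hx; have [q0 qE] := phi_invE hy.
  rewrite leNgt; apply/negP => qp.
  have := phi_expanding i q0 (ltW qp); rewrite pE qE.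
  have : 0 < (1 - c i) * (phi_inv tau i (Num.max x (- tau i 0)) - phi_inv tau i (Num.max y (- tau i 0))).
    by rewrite mulr_gt0// subr_gt0.
  have : Num.max x (- tau i 0) <= Num.max y (- tau i 0) by rewrite ge_max hy andbT le_max xy.
  lra.
rewrite (_ : abs_k_phi_inv tau k i = (fun z => if - tau i 0 <= z then `|k_ext i (psi z)| else 0)); last first.
  apply/funext => z; rewrite /abs_k_phi_inv; case: ifPn => // hz.
  by rewrite /psi (max_idPl hz) k_extE// (phi_invE hz).1.
apply: measurable_fun_ifT.
- by apply: measurable_fun_ler; [exact: measurable_cst|exact: measurable_id].
- apply: measurableT_comp => //; apply: measurableT_comp => //.
  exact: k_ext_measurable.
- exact: measurable_cst.
Qed.

Lemma abs_k_phi_inv_ge0 i z : 0 <= abs_k_phi_inv tau k i z.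
Proof. by rewrite /abs_k_phi_inv; case: ifPn. Qed.

Lemma abs_k_phi_invE i s : 0 <= s -> abs_k_phi_inv tau k i (phi tau i s) = `|k i s|.
Proof.
by move=> s0; rewrite /abs_k_phi_inv phi_invK// phi_ge.
Qed.

(** The coefficient with which the unknown enters the i-th delay term. Times with [phi_ext i s <= 0]
    read the initial datum and are counted by [delay_datum]. *)
Definition delay_weight (b : nat -> R) i s : R :=
  if 0 < phi_ext i s then b i * `|k_ext i s| else 0.

Lemma delay_weight_measurable b i : measurable_fun setT (delay_weight b i).
Proof.
apply: measurable_fun_ifT.
- by apply: measurable_fun_ltr; [exact: measurable_cst|exact: phi_ext_measurable].
- apply: measurable_funM; first exact: measurable_cst.
  by apply: measurableT_comp => //; exact: k_ext_measurable.
- exact: measurable_cst.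
Qed.

(** The weight is [h] composed with [phi_ext i], and [1 / (1 - c i)] is the cost of the change of
    variables. At negative times [phi_ext i] is negative, so weight and composite are both 0. *)
Lemma integral_delay_weight_le b i : 0 <= b i ->
  (\int[mu]_s (delay_weight b i s)%:E <= \int[mu]_(z in `[0%R, +oo[)
     (b i / (1 - c i) * abs_k_phi_inv tau k i z)%:E)%E.
Proof.
move=> b0; pose h z := (if 0 < z then b i * abs_k_phi_inv tau k i z else 0)%R.
have h0 z : 0 <= h z by rewrite /h; case: ifPn => // _; rewrite mulr_ge0// abs_k_phi_inv_ge0.
have mh : measurable_fun setT (EFin \o h).
  apply/measurable_EFinP; apply: measurable_fun_ifT.
  - by apply: measurable_fun_ltr; [exact: measurable_cst|exact: measurable_id].
  - apply: measurable_funM; first exact: measurable_cst.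
    exact: abs_k_phi_inv_measurable.
  - exact: measurable_cst.
have -> : (\int[mu]_s (delay_weight b i s)%:E = \int[mu]_s (h (phi_ext i s))%:E)%E.
  apply: eq_integral => s _; congr EFin; rewrite /delay_weight /h; case: ifPn => // ps.
  have s0 : 0 <= s.
    rewrite leNgt; apply/negP => s0; move: ps; rewrite /phi_ext leNgt s0 /=.
    have := Htau_ge0 i (lexx 0); have : (1 - c i) * s < 0 by rewrite pmulr_rlt0.
    by move=> ? ?; apply/negP; rewrite -leNgt; lra.
  by rewrite /phi_ext s0 abs_k_phi_invE// k_extE.
apply: le_trans (expanding_integral_le (c1 i) (phi_ext_expanding i) (phi_ext_measurable i) mh _) _.
  by move=> x; rewrite lee_fin.
rewrite -ge0_integralZl_EFin//; last 2 first.
- by move=> x _; rewrite lee_fin.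
- by rewrite invr_ge0 ltW.
rewrite [leRHS]integral_mkcond; apply: ae_le_lower_integral.
- by move=> x _; rewrite -EFinM lee_fin mulr_ge0// invr_ge0 ltW.
- move=> x _; apply: erestrict_ge0 => y _; rewrite lee_fin mulr_ge0 ?abs_k_phi_inv_ge0//.
  by rewrite divr_ge0// ltW.
apply: aeW => z _; rewrite patchE mem_setE in_itv /= andbT /h.
case: ifPn => [z0|_]; first by rewrite (ltW z0) -EFinM lee_fin mulrA [_^-1 * _]mulrC.
rewrite mule0; case: ifPn => // _; rewrite lee_fin mulr_ge0 ?abs_k_phi_inv_ge0//.
by rewrite divr_ge0// ltW.
Qed.

(** * Extension and integrals of the initial data *)

Context {H : normedModType R}.
Variable g : nat -> R -> H.
Hypothesis Hg : forall i : nat, {within delay_set tau, continuous (g i)}.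

(** Clamping to [[- tau i 0, 0]] turns [g i], continuous only relative to [delay_set], into a
    function continuous on the whole line, without changing any value that the i-th delay term
    reads. *)
Definition g_ext i (z : R) : H := g i (Num.max (Num.min z 0) (- tau i 0)).

Lemma g_extE i z : - tau i 0 <= z -> z <= 0 -> g_ext i z = g i z.
Proof. by move=> h1 h2; rewrite /g_ext (min_idPl h2) (max_idPl h1). Qed.

(** [delay_set] is a union over all indices, but [phi tau i s] never falls below [- tau i 0], so
    only the right end point decides. *)
Lemma delay_setP i s : 0 <= s -> (phi tau i s \in delay_set tau) = (phi tau i s <= 0).
Proof.
move=> s0; apply/idP/idP => [/set_mem[j _] /=|h].
  by rewrite in_itv /= => /andP[].
apply/mem_set; exists i => //=; rewrite in_itv /= h andbT.
exact: phi_ge.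
Qed.

Lemma g_ext_continuous i : continuous (g_ext i).
Proof.
move=> z.
have cl x : delay_set tau (Num.max (Num.min x 0) (- tau i 0)).
  exists i => //=; rewrite in_itv /= le_max lexx orbT /= ge_max ge_min lexx orbT /=.
  by rewrite oppr_le0; exact: Htau_ge0.
have /subspace_continuousP/(_ _ (cl z)) hg := @Hg i.
have cc : (Num.max (Num.min x 0) (- tau i 0) : R) @[x --> z] -->
    within (delay_set tau) (nbhs (Num.max (Num.min z 0) (- tau i 0))).
  move=> P /=; rewrite /within /= => hP.
  have : (Num.max (Num.min x 0) (- tau i 0) : R) @[x --> z] --> Num.max (Num.min z 0) (- tau i 0).
    apply: (@cvg_comp _ _ _ (fun x : R => Num.min x 0) (fun x : R => Num.max x (- tau i 0)) _ (nbhs (Num.min z 0))).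
      exact: continuous_minr_cst.
    exact: continuous_maxr_cst.
  by move=> /(_ _ hP); apply: (@filterS _ (nbhs z)) => x; apply; exact: cl.
exact: (cvg_comp _ _ cc hg).
Qed.

Definition delay_datum i s : R :=
  if phi_ext i s <= 0 then `|k_ext i s| * `|g_ext i (phi_ext i s)| else 0.

Lemma g_ext_strongly_measurable i : strongly_measurable (fun s => g_ext i (phi_ext i s)).
Proof.
apply: (@strongly_measurable_precomp _ _ _ _ _ _ (g_ext i)).
  exact: phi_ext_measurable.
by apply: continuous_strongly_measurable; exact: g_ext_continuous.
Qed.

Lemma delay_datum_measurable i : measurable_fun setT (delay_datum i).
Proof.
apply: measurable_fun_ifT.
- by apply: measurable_fun_ler; [exact: phi_ext_measurable|exact: measurable_cst].
- apply: measurable_funM.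
    by apply: measurableT_comp => //; exact: k_ext_measurable.
  by apply: measurable_norm; exact: g_ext_strongly_measurable.
- exact: measurable_cst.
Qed.

(** Used to discard the end points [0] and [- tau i 0], since the data integral of the smallness
    hypothesis runs over an open interval. *)
Lemma phi_ext_preimage1_null i (z : R) : {ae mu, forall s, phi_ext i s <> z}.
Proof.
exists (phi_ext i @^-1` [set z]); split => //=.
- by rewrite -[X in measurable X]setTI; apply: phi_ext_measurable.
- have := expanding_preimage_le (c1 i) (phi_ext_expanding i) (phi_ext_measurable i) (measurable_set1 z).
  rewrite lebesgue_measure_set1 => h; apply/eqP; rewrite eq_le measure_ge0 andbT.
  by rewrite -(@pmule_rle0 _ (1 - c i)%:E)// lte_fin.
- by move=> s /= /contrapT.
Qed.

Lemma integral_delay_datum_le i :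
  (\int[mu]_s (delay_datum i s)%:E <=
   \int[mu]_(z in [set z : R | - tau_star tau < z%:E < 0])
     ((1 - c i)^-1 * abs_k_phi_inv tau k i z * `|g i z|)%:E)%E.
Proof.
pose h z := (if - tau i 0 < z < 0 then abs_k_phi_inv tau k i z * `|g_ext i z| else 0)%R.
have h0 z : 0 <= h z by rewrite /h; case: ifPn => // _; rewrite mulr_ge0// abs_k_phi_inv_ge0.
have mh : measurable_fun setT (EFin \o h).
  apply/measurable_EFinP; apply: measurable_fun_ifT.
  - apply: measurable_and; first by apply: measurable_fun_ltr; [exact: measurable_cst|exact: measurable_id].
    by apply: measurable_fun_ltr; [exact: measurable_id|exact: measurable_cst].
  - apply: measurable_funM; first exact: abs_k_phi_inv_measurable.
    apply: measurable_norm; apply: continuous_strongly_measurable; exact: g_ext_continuous.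
  - exact: measurable_cst.
apply: (@le_trans _ _ (\int[mu]_s (h (phi_ext i s))%:E)%E).
  apply: ae_le_lower_integral.
  - by move=> x _; rewrite lee_fin /delay_datum; case: ifPn => // _; rewrite mulr_ge0.
  - by move=> x _; rewrite lee_fin.
  apply: (ae_imply2 _ (phi_ext_preimage1_null i 0) (phi_ext_preimage1_null i (- tau i 0))).
  move=> s n0 nt _; rewrite lee_fin /delay_datum; case: ifPn => // ps.
  have [s0|s0] := leP 0 s; last by rewrite k_ext0// normr0 mul0r.
  have e : phi_ext i s = phi tau i s by rewrite /phi_ext s0.
  rewrite /h ifT; first by rewrite {2}e abs_k_phi_invE// k_extE.
  rewrite !lt_neqAle ps {2}e phi_ge// !andbT; apply/andP; split; apply/eqP => // e'.
  exact/nt/esym.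
apply: le_trans (expanding_integral_le (c1 i) (phi_ext_expanding i) (phi_ext_measurable i) mh _) _.
  by move=> x; rewrite lee_fin.
rewrite -ge0_integralZl_EFin//; last 2 first.
- by move=> x _; rewrite lee_fin.
- by rewrite invr_ge0 ltW.
have nn x : 0 <= (1 - c i)^-1 * abs_k_phi_inv tau k i x * `|g i x|.
  by rewrite mulr_ge0// mulr_ge0 ?abs_k_phi_inv_ge0// invr_ge0 ltW.
rewrite [leRHS]integral_mkcond; apply: ae_le_lower_integral.
- by move=> x _; rewrite -EFinM lee_fin mulr_ge0// invr_ge0 ltW.
- by move=> x _; apply: erestrict_ge0 => y _; rewrite lee_fin.
apply: aeW => z _; rewrite patchE /h /=; case: ifPn => [/andP[z1 z2]|_].
  rewrite mem_set.
    by rewrite -EFinM lee_fin -mulrA g_extE// ltW.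
  rewrite /= lte_fin z2 andbT; apply: (@le_lt_trans _ _ (- tau i 0)%:E); last by rewrite lte_fin.
  rewrite EFinN leeN2; apply: ereal_sup_ubound; exists i => //.
by rewrite mule0; case: ifPn => // _; rewrite lee_fin.
Qed.

End delay_theory.

(** * Series and limits *)

Lemma series_dominated (R : realType) (H : completeNormedModType R) (u : nat -> H)
    (w : nat -> R) : (forall i, `|u i| <= w i) ->
  (\sum_(0 <= i <oo) (w i)%:E < +oo)%E ->
  cvgn (series u) /\ (`|limn (series u)|%:E <= \sum_(0 <= i <oo) (w i)%:E)%E.
Proof.
move=> uw Woo.
have w0 i : 0 <= w i by exact: le_trans (uw i).
set WE := (\sum_(0 <= i <oo) (w i)%:E)%E in Woo *.
have WE0 : (0 <= WE)%E by apply: nneseries_ge0 => i _ _; rewrite lee_fin.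
have WEfin : WE \is a fin_num by rewrite ge0_fin_numE.
have part n : \sum_(0 <= i < n) `|u i| <= fine WE.
  rewrite -lee_fin fineK// -sumEFin; apply: le_trans (nneseries_lim_ge n _); last first.
    by move=> i _ _; rewrite lee_fin.
  by apply: lee_sum => i _; rewrite lee_fin.
have cv : cvgn (series u).
  apply: normed_cvg; apply: nondecreasing_is_cvgn.
    by apply: (@nondecreasing_series _ (fun i => `|u i|) xpredT 0) => n _ _; exact: normr_ge0.
  by exists (fine WE) => _ [n _ <-]; exact: part.
split => //.
rewrite -(fineK WEfin) lee_fin.
have cn : `|series u n| @[n --> \oo] --> `|limn (series u)| by apply: cvg_norm.
rewrite -(cvg_lim _ cn)//; apply: limr_le; first by apply/cvg_ex; eexists; exact: cn.
apply: nearW => n; apply: le_trans (part n); exact: ler_norm_sum.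
Qed.

Lemma le_geometric0 (R : realType) (x C q : R) : 0 <= q < 1 ->
  (forall n, x <= C * q ^+ n) -> x <= 0.
Proof.
move=> /andP[q0 q1] h.
have cv : geometric C q n @[n --> \oo] --> 0 by apply: cvg_geometric; rewrite ger0_norm.
rewrite -(cvg_lim _ cv)//; apply: limr_ge; first by apply/cvg_ex; eexists; exact: cv.
exact: nearW.
Qed.

Lemma geometric_limit (R : realType) (H : completeNormedModType R) (x : nat -> H) (C q : R) :
  0 <= C -> 0 <= q < 1 -> (forall n, `|x n.+1 - x n| <= C * q ^+ n) ->
  exists l, forall n, `|l - x n| <= C / (1 - q) * q ^+ n.
Proof.
move=> C0 /andP[q0 q1] hx; have q10 : 0 < 1 - q by rewrite subr_gt0.
have q1n : 1 - q != 0 by rewrite gt_eqF.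
(* Keeping the exact geometric remainder, rather than [q ^+ n] alone, is what lets the induction on
   [j] close. *)
have tail n j : `|x (j + n)%N - x n| <= C / (1 - q) * (q ^+ n - q ^+ (j + n)).
  elim: j => [|j IH]; first by rewrite subrr normr0 add0n subrr mulr0.
  rewrite (_ : x (j.+1 + n)%N - x n = (x (j + n).+1 - x (j + n)%N) + (x (j + n)%N - x n)); last first.
    by rewrite addrA subrK.
  apply: le_trans (ler_normD _ _) _.
  apply: le_trans (lerD (hx _) IH) _.
  by rewrite le_eqVlt; apply/orP; left; apply/eqP; rewrite addSn exprS; field.
have tail' n m : (n <= m)%N -> `|x m - x n| <= C / (1 - q) * q ^+ n.
  move=> nm; rewrite -(subnK nm); apply: le_trans (tail _ _) _.
  apply: ler_wpM2l; first by rewrite divr_ge0// ltW.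
  by rewrite gerBl exprn_ge0.
have cg : geometric (C / (1 - q)) q n @[n --> \oo] --> 0.
  by apply: cvg_geometric; rewrite ger0_norm.
have cx : cvgn x.
  apply: cauchy_cvg; apply: cauchy_exP => e e0.
  have /cvgr_lt/(_ e e0) [N _ hN] := cg.
  exists (x N); exists N => // m /= Nm; rewrite -ball_normE /= distrC.
  by apply: le_lt_trans (tail' _ _ Nm) _; apply: hN => /=.
exists (limn x) => n.
have cn : `|x m - x n| @[m --> \oo] --> `|limn x - x n|.
  by apply: cvg_norm; apply: cvgB => //; exact: cvg_cst.
rewrite -(cvg_lim _ cn)//; apply: limr_le; first by apply/cvg_ex; eexists; exact: cn.
by exists n => // m /= nm; exact: tail'.
Qed.

Lemma integral_expR_le (R : realType) (d t : R) : 0 < d -> 0 <= t ->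
  (\int[@lebesgue_measure R]_(s in `[0%R, t]) (expR (d * s))%:E <= (expR (d * t) / d)%:E)%E.
Proof.
move=> d0; rewrite le_eqVlt => /predU1P[<-|t0].
  by rewrite set_itv1 integral_set1 lee_fin divr_ge0 ?expR_ge0// ltW.
have dF (x : R) : is_derive x 1 (fun s => d^-1 * expR (d * s)) (expR (d * x)).
  have h1 : is_derive x 1 (fun s : R => d * s) d.
    apply: (@is_derive_eq _ _ _ (d \*: id)).
    by rewrite /GRing.scale /= mulr1.
  have h2 : is_derive x 1 (expR \o (fun s : R => d * s)) (expR (d * x) * d).
    exact: is_derive1_comp.
  apply: (@is_derive_eq _ _ _ (d^-1 \*: (expR \o (fun s : R => d * s)))).
  by rewrite /GRing.scale /= mulrCA mulVf ?mulr1// gt_eqF.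
have cE : continuous (fun s : R => expR (d * s)).
  move=> x; apply: (@continuous_cvg _ _ _ _ _ _ expR); first exact: continuous_expR.
  by apply: cvgMr; exact: cvg_id.
have cF : continuous (fun s : R => d^-1 * expR (d * s)).
  by move=> x; apply: cvgMr; exact: cE.
rewrite (@continuous_FTC2 _ _ (fun s => d^-1 * expR (d * s)))//.
- rewrite -EFinB lee_fin [leRHS]mulrC gerBl.
  by rewrite mulr_ge0 ?expR_ge0// invr_ge0 ltW.
- exact: continuous_subspaceT.
- split; first by move=> x _; have [] := dF x.
    by apply: cvg_at_right_filter; exact: cF.
  by apply: cvg_at_left_filter; exact: cF.
- by move=> x _; rewrite derive1E; exact: derive_val.
Qed.

(** Comparison with this integral turns [bochner_dist_le] into a bound on a single integral. *)
Lemma bochner_integral0 d (T : measurableType d) (R : realType)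
   (mu : {measure set T -> \bar R}) (H : normedModType R) D :
  is_bochner_integral mu D (fun=> 0 : H) 0.
Proof.
pose s0 : simple_fun mu H := @SimpleFun _ _ _ _ _ 0 (fun=> set0) (fun=> 0)
   (fun=> measurable0) (fun _ => eq_ind_r (fun z => (z < +oo)%E) (ltry 0) (measure0 mu)).
have e x : sf_eval s0 x = 0 by rewrite /sf_eval big_ord0.
exists (fun=> s0); split.
- by apply: aeW => x _; rewrite e; exact: cvg_cst.
- under eq_fun do under eq_integral do rewrite e subrr normr0.
  by rewrite integral0; exact: cvg_cst.
- by rewrite /sf_integral big_ord0; exact: cvg_cst.
Qed.

(** Reduces continuity in time to sequences, the form to which dominated convergence applies. *)
Lemma cvg_seq_criterion (R : realType) (K : normedModType R) (f : R -> K) (t : R) (l : K) :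
  (forall u : nat -> R, u n @[n --> \oo] --> t -> f (u n) @[n --> \oo] --> l) ->
  f x @[x --> t] --> l.
Proof.
move=> h; apply/cvgrPdist_lt => e e0; apply: contrapT => nh.
have /choice [u hu] (n : nat) : exists x : R, `|t - x| < n.+1%:R^-1 /\ ~ (`|l - f x| < e).
  apply: contrapT => /forallNP hx; apply: nh; apply/nbhs_ballP.
  exists n.+1%:R^-1; first by rewrite /= invr_gt0.
  move=> x tx.
  by have /not_andP[//|/contrapT] := hx x.
have ut : u n @[n --> \oo] --> t.
  apply/(@cvgrPdist_lt _ R^o) => r r0; have [N _ hN] := near_infty_natSinv_lt (PosNum r0).
  by exists N => // n /= Nn; apply: lt_trans (hu n).1 _; exact: hN.
have /cvgrPdist_lt/(_ e e0) [N _ hN] := h u ut.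
by apply: (hu N).2; apply: hN => /=.
Qed.

(** * Duhamel map *)

Lemma lebesgue_measure_itvcc_lty (R : realType) (a b : R) :
  (@lebesgue_measure R `[a, b]%classic < +oo)%E.
Proof. by rewrite lebesgue_measure_itv /=; case: ifPn => // _; rewrite -EFinB ltry. Qed.

Section duhamel.
Context {R : realType} {H : completeNormedModType R}.
Local Notation mu := (@lebesgue_measure R).
Variables (S : R -> {linear H -> H}) (M omega : R).
Hypothesis HS : C0_semigroup S.
Hypothesis HM : 0 < M.
Hypothesis Homega : 0 < omega.
Hypothesis HSbound : forall t : R, 0 <= t -> opnorm (S t) <= M * expR (omega * t).
Variables (tau : nat -> R -> R) (c : nat -> R).
Hypothesis Htau_ge0 : forall (i : nat) (t : R), 0 <= t -> 0 <= tau i t.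
Hypothesis Htau_diff : forall (i : nat) (t : R), 0 <= t ->
  exists2 l : R, is_derive_within `[0, +oo[ (tau i) t l & l <= c i.
Hypothesis Hc : forall i : nat, c i < 1.
Variable B : nat -> {linear H -> H}.
Hypothesis HB : forall i : nat, bounded_op (B i).
Variable k : nat -> R -> R.
Hypothesis Hk : forall i : nat, L1loc `[0, +oo[ (k i).
Variables (F : H -> H) (L : R).
Hypothesis HL : 0 < L.
Hypothesis HF : forall x y, `|F x - F y| <= L * `|x - y|.
Hypothesis HF0 : F 0 = 0.
Variables (U0 : H) (g : nat -> R -> H).
Hypothesis Hg : forall i : nat, {within delay_set tau, continuous (g i)}.

Local Notation weight := (delay_weight tau c k (fun i => opnorm (B i))).
Local Notation datum := (delay_datum tau c k g).

Definition weight_sum (s : R) : \bar R := (\sum_(0 <= i <oo) (weight i s)%:E)%E.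
Definition datum_sum (s : R) : \bar R := (\sum_(0 <= i <oo) (datum i s)%:E)%E.

Lemma weight_ge0 i s : 0 <= weight i s.
Proof.
by rewrite /delay_weight; case: ifPn => // _; rewrite mulr_ge0//; exact: opnorm_ge0.
Qed.

Lemma datum_ge0 i s : 0 <= datum i s.
Proof. by rewrite /delay_datum; case: ifPn => // _; rewrite mulr_ge0. Qed.

Lemma weight_sum_ge0 s : (0 <= weight_sum s)%E.
Proof. by apply: nneseries_ge0 => i _ _; rewrite lee_fin weight_ge0. Qed.

Lemma datum_sum_ge0 s : (0 <= datum_sum s)%E.
Proof. by apply: nneseries_ge0 => i _ _; rewrite lee_fin datum_ge0. Qed.

Lemma weight_sum_measurable : measurable_fun setT weight_sum.
Proof.
apply: (@ge0_emeasurable_sum _ _ _ setT (fun i s => (weight i s)%:E) xpredT).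
  by move=> i s _ _; rewrite lee_fin weight_ge0.
by move=> i _; apply/measurable_EFinP; exact: delay_weight_measurable.
Qed.

Lemma datum_sum_measurable : measurable_fun setT datum_sum.
Proof.
apply: (@ge0_emeasurable_sum _ _ _ setT (fun i s => (datum i s)%:E) xpredT).
  by move=> i s _ _; rewrite lee_fin datum_ge0.
by move=> i _; apply/measurable_EFinP; exact: delay_datum_measurable.
Qed.

(** [kappa] is the second sum and [G] the first sum without its exponential factor; sum and integral
    are exchanged by nonnegativity. *)
Lemma smallness_constants :
  (expeR (omega%:E * tau_star tau)
      * (\sum_(0 <= i <oo)
           \int[@lebesgue_measure R]_(z in
               [set z : R | - tau_star tau < z%:E < 0])
             ((1 - c i)^-1 * abs_k_phi_inv tau k i z * `|g i z|)%:E)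
    + \sum_(0 <= i <oo)
        \int[@lebesgue_measure R]_(z in `[0%R, +oo[)
          (opnorm (B i) / (1 - c i) * abs_k_phi_inv tau k i z)%:E
    < M^-1%:E)%E ->
  exists kappa G, [/\ 0 <= kappa, M * kappa < 1, 0 <= G,
    (\int[mu]_s weight_sum s <= kappa%:E)%E & (\int[mu]_s datum_sum s <= G%:E)%E].
Proof.
set e := expeR _; set X := (X in (_ * X + _)%E); set Y := (X in (_ + X)%E) => XY.
have ic i : 0 < (1 - c i)^-1 by rewrite invr_gt0 subr_gt0.
have X0 : (0 <= X)%E.
  apply: nneseries_ge0 => i _ _; apply: integral_ge0 => z _; rewrite lee_fin.
  by rewrite mulr_ge0// mulr_ge0 ?abs_k_phi_inv_ge0// ltW.
have Y0 : (0 <= Y)%E.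
  apply: nneseries_ge0 => i _ _; apply: integral_ge0 => z _; rewrite lee_fin.
  by rewrite mulr_ge0 ?abs_k_phi_inv_ge0// mulr_ge0 ?opnorm_ge0// ltW.
have wY : (\int[mu]_s weight_sum s <= Y)%E.
  rewrite /weight_sum integral_nneseries//; last 2 first.
  + by move=> i; apply/measurable_EFinP; exact: delay_weight_measurable.
  + by move=> i s _; rewrite lee_fin weight_ge0.
  apply: lee_nneseries => i _; first by move=> _; apply: integral_ge0 => z _; rewrite lee_fin weight_ge0.
  by apply: integral_delay_weight_le => //; exact: opnorm_ge0.
have dX : (\int[mu]_s datum_sum s <= X)%E.
  rewrite /datum_sum integral_nneseries//; last 2 first.
  + by move=> i; apply/measurable_EFinP; exact: delay_datum_measurable.
  + by move=> i s _; rewrite lee_fin datum_ge0.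
  apply: lee_nneseries => i _; first by move=> _; apply: integral_ge0 => z _; rewrite lee_fin datum_ge0.
  exact: integral_delay_datum_le.
clearbody X Y.
(* As [tau_star] is at least [tau 0 0 >= 0], the factor is at least 1, possibly [+oo]; so the sum
   [X] alone is below [e * X] and is finite. *)
have e1 : (1 <= e)%E.
  rewrite -expeR0 /e lee_expeR mule_ge0//; first by rewrite lee_fin ltW.
  by apply: le_ereal_sup_tmp; exists (tau 0 0)%:E; [exists 0%N|rewrite lee_fin Htau_ge0].
have eX : (X <= e * X)%E by apply: lee_pemull.
have Yle : (Y < M^-1%:E)%E.
  by apply: le_lt_trans XY; rewrite leeDr// (le_trans X0).
have Xle : (X < +oo)%E.
  apply: (@lt_trans _ _ M^-1%:E); last exact: ltry.
  by apply: le_lt_trans XY; apply: (le_trans eX); rewrite leeDl.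
have Yfin : Y \is a fin_num by rewrite ge0_fin_numE// (lt_trans Yle) ?ltry.
have Xfin : X \is a fin_num by rewrite ge0_fin_numE.
exists (fine Y), (fine X); split; rewrite ?fine_ge0 ?fineK//.
by rewrite mulrC -ltr_pdivlMr// div1r -lte_fin fineK.
Qed.

Lemma delayedE (V : R -> H) i s : 0 <= s -> delayed tau B g V i s =
  if phi_ext tau c i s <= 0 then g_ext tau g i (phi_ext tau c i s)
  else B i (V (phi_ext tau c i s)).
Proof.
move=> s0; rewrite /delayed (delay_setP Htau_diff Hc)// /phi_ext s0.
by case: ifPn => // ps; rewrite g_extE// (phi_ge Htau_diff Hc).
Qed.

Lemma phi_ext_le i s : 0 <= s -> phi_ext tau c i s <= s.
Proof. by move=> s0; rewrite /phi_ext s0 /phi gerBl Htau_ge0. Qed.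

Lemma delay_term_le (V : R -> H) s K i : 0 <= s ->
  (forall r, 0 <= r <= s -> `|V r| <= K) ->
  `|k i s *: delayed tau B g V i s| <= datum i s + weight i s * K.
Proof.
move=> s0 VK; rewrite normrZ delayedE// /delay_datum /delay_weight k_extE//.
have [ps|ps] := leP (phi_ext tau c i s) 0; first by rewrite mul0r addr0.
rewrite add0r -mulrA mulrCA; apply: ler_wpM2l => //.
apply: le_trans (le_opnorm _ (HB i)) _; apply: ler_wpM2l; first exact: opnorm_ge0.
by apply: VK; rewrite (ltW ps) phi_ext_le.
Qed.

(** Where the datum is read the two terms coincide, so only [weight] enters the contraction
    constant. Since [phi_ext i s <= s], bounds on [[0, s]] are enough. *)
Lemma delay_term_dist (V W : R -> H) s K i : 0 <= s ->
  (forall r, 0 <= r <= s -> `|V r - W r| <= K) ->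
  `|k i s *: delayed tau B g V i s - k i s *: delayed tau B g W i s| <= weight i s * K.
Proof.
move=> s0 VK; rewrite -scalerBr normrZ !delayedE// /delay_weight k_extE//.
have [ps|ps] := leP (phi_ext tau c i s) 0; first by rewrite subrr normr0 mulr0 mul0r.
rewrite -mulrA mulrCA; apply: ler_wpM2l => //; rewrite -linearB.
apply: le_trans (le_opnorm _ (HB i)) _; apply: ler_wpM2l; first exact: opnorm_ge0.
by apply: VK; rewrite (ltW ps) phi_ext_le.
Qed.

Definition source (V : R -> H) s := limn (delay_series tau k B g V s) + F (V s).

(** At these times the delay series converges absolutely for every input bounded on [[0, s]]; they
    do not depend on the input. *)
Definition good s := [&& 0 <= s, (datum_sum s < +oo)%E & (weight_sum s < +oo)%E].

Lemma source_le (V : R -> H) s K : good s ->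
  (forall r, 0 <= r <= s -> `|V r| <= K) ->
  cvgn (delay_series tau k B g V s) /\
  (`|source V s|%:E <= datum_sum s + (weight_sum s + L%:E) * K%:E)%E.
Proof.
move=> /and3P[s0 doo woo] VK.
have K0 : 0 <= K by apply: le_trans (VK s _) => //; rewrite s0 lexx.
have sumE : (\sum_(0 <= i <oo) (datum i s + weight i s * K)%:E = datum_sum s + weight_sum s * K%:E)%E.
  under eq_eseriesr do rewrite EFinD.
  rewrite nneseriesD.
  - congr (_ + _)%E; under eq_eseriesr do rewrite EFinM muleC.
    rewrite nneseriesZl 1?muleC// => i _; by rewrite lee_fin weight_ge0.
  - by move=> i _ _; rewrite lee_fin datum_ge0.
  - by move=> i _ _; rewrite lee_fin mulr_ge0// weight_ge0.
have [|cv lim] := series_dominated (fun i => delay_term_le i s0 VK).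
  by rewrite sumE lte_add_pinfty// muleC lte_mul_pinfty.
split => //.
apply: (@le_trans _ _ (`|limn (delay_series tau k B g V s)|%:E + (L * K)%:E)%E).
  rewrite -EFinD lee_fin; apply: le_trans (ler_normD _ _) _; apply: lerD => //.
  have := HF (V s) 0; rewrite HF0 !subr0 => /le_trans; apply.
  by rewrite ler_pM2l// VK// s0 lexx.
rewrite ge0_muleDl ?weight_sum_ge0 ?lee_fin ?(ltW HL)// -EFinM addeA leeD2r//.
by rewrite -sumE.
Qed.

Lemma source_dist (V W : R -> H) s K : good s ->
  cvgn (delay_series tau k B g V s) -> cvgn (delay_series tau k B g W s) ->
  (forall r, 0 <= r <= s -> `|V r - W r| <= K) ->
  (`|source V s - source W s|%:E <= (weight_sum s + L%:E) * K%:E)%E.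
Proof.
move=> /and3P[s0 doo woo] cV cW VK.
have K0 : 0 <= K by apply: le_trans (VK s _) => //; rewrite s0 lexx.
have sumE : (\sum_(0 <= i <oo) (weight i s * K)%:E = weight_sum s * K%:E)%E.
  under eq_eseriesr do rewrite EFinM muleC.
  rewrite nneseriesZl 1?muleC// => i _; by rewrite lee_fin weight_ge0.
have [|cv lim] := series_dominated (fun i => delay_term_dist i s0 VK).
  by rewrite sumE muleC lte_mul_pinfty.
have limE : limn (delay_series tau k B g V s) - limn (delay_series tau k B g W s) =
  limn (series (fun i => k i s *: delayed tau B g V i s - k i s *: delayed tau B g W i s)).
  rewrite -limB//; congr (limn _); apply/funext => n.
  by rewrite [RHS]/series /= sumrB.
rewrite ge0_muleDl ?weight_sum_ge0 ?lee_fin ?(ltW HL)// -EFinM.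
rewrite (_ : source V s - source W s = (limn (delay_series tau k B g V s) - limn (delay_series tau k B g W s)) + (F (V s) - F (W s))); last first.
  by rewrite /source opprD addrACA.
apply: (@le_trans _ _ (`|limn (delay_series tau k B g V s) - limn (delay_series tau k B g W s)|%:E + (L * K)%:E)%E).
  rewrite -EFinD lee_fin; apply: le_trans (ler_normD _ _) _; apply: lerD => //.
  apply: le_trans (HF _ _) _.
  by rewrite ler_pM2l// VK// s0 lexx.
by rewrite leeD2r// limE -sumE.
Qed.

(** * Weighted estimates and the contraction constant *)

Variables (kappa G lambda q : R).
Hypothesis kappa0 : 0 <= kappa.
Hypothesis G0 : 0 <= G.
Hypothesis intw : (\int[mu]_s weight_sum s <= kappa%:E)%E.
Hypothesis intd : (\int[mu]_s datum_sum s <= G%:E)%E.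
Hypothesis lambda_gt : omega < lambda.
Hypothesis qE : q = M * kappa + M * L / (lambda - omega).

Lemma good_ae : {ae mu, forall s, 0 <= s -> good s}.
Proof.
have fin (f : R -> \bar R) C : measurable_fun setT f -> (forall s, 0 <= f s)%E ->
    (\int[mu]_s f s <= C%:E)%E -> {ae mu, forall s, (f s < +oo)%E}.
  move=> mf f0 fC.
  have intf : mu.-integrable setT f.
    apply/integrableP; split => //.
    under eq_integral do rewrite gee0_abs//.
    by apply: le_lt_trans fC _; rewrite ltry.
  apply: (ae_imply _ (integrable_ae measurableT intf)) => s /(_ I).
  by rewrite ge0_fin_numE.
apply: (ae_imply2 _ (fin _ _ datum_sum_measurable datum_sum_ge0 intd)
  (fin _ _ weight_sum_measurable weight_sum_ge0 intw)).
by move=> s h1 h2 s0; apply/and3P.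
Qed.

Lemma good_measurable : measurable_fun setT good.
Proof.
apply: measurable_and.
  by apply: measurable_fun_ler; [exact: measurable_cst|exact: measurable_id].
apply: measurable_and.
  by apply: measurable_fun_lte; [exact: datum_sum_measurable|exact: measurable_cst].
by apply: measurable_fun_lte; [exact: weight_sum_measurable|exact: measurable_cst].
Qed.

(** Bounds the Duhamel integrand for inputs of size [K * expR (lambda * r)]. Here [gam] is
    [datum_sum] for norms and 0 for differences, so one estimate serves both. *)
Definition majorant (gam : R -> \bar R) t K s : \bar R :=
  ((M * expR (omega * (t - s)))%:E *
   (gam s + (weight_sum s + L%:E) * (K * expR (lambda * s))%:E))%E.

Lemma majorant_ge0 gam t K s : 0 <= K -> (0 <= gam s)%E -> (0 <= majorant gam t K s)%E.
Proof.
move=> K0 g0; rewrite mule_ge0//; first by rewrite lee_fin mulr_ge0 ?expR_ge0// ltW.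
rewrite adde_ge0// mule_ge0//; last by rewrite lee_fin mulr_ge0 ?expR_ge0.
by rewrite adde_ge0 ?weight_sum_ge0// lee_fin ltW.
Qed.

Lemma majorant_measurable gam t K : measurable_fun setT gam ->
  measurable_fun setT (majorant gam t K).
Proof.
move=> mg; apply: emeasurable_funM.
  apply/measurable_EFinP/measurable_funM; first exact: measurable_cst.
  apply: measurableT_comp; first exact: measurable_expR.
  apply: measurable_funM; first exact: measurable_cst.
  by apply: measurable_funB; [exact: measurable_cst|exact: measurable_id].
apply: emeasurable_funD => //; apply: emeasurable_funM.
  by apply: emeasurable_funD; [exact: weight_sum_measurable|exact: measurable_cst].
apply/measurable_EFinP/measurable_funM; first exact: measurable_cst.
apply: measurableT_comp; first exact: measurable_expR.
by apply: measurable_funM; [exact: measurable_cst|exact: measurable_id].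
Qed.

(** The origin of [q]. Data and weights are known only through their L1 norms, so their exponentials
    are bounded by [expR (lambda * t)], giving [M * C] and [M * kappa * K]. The Lipschitz term is
    integrated exactly in its exponential [expR ((lambda - omega) * s)] up to a dropped negative end
    point, giving [M * L / (lambda - omega) * K]. *)
Lemma integral_majorant_le gam C t K : 0 <= t -> 0 <= K ->
  measurable_fun setT gam -> (forall s, 0 <= gam s)%E ->
  (\int[mu]_s gam s <= C%:E)%E ->
  (\int[mu]_(s in `[0%R, t]) majorant gam t K s <= (expR (lambda * t) * (M * C + q * K))%:E)%E.
Proof.
move=> t0 K0 mg g0 gC.
have d0 : 0 < lambda - omega by rewrite subr_gt0.
have M0 := ltW HM; have L0 := ltW HL.
pose f1 s := ((M * expR (lambda * t))%:E * gam s)%E.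
pose f2 s := ((M * K * expR (lambda * t))%:E * weight_sum s)%E.
pose f3 s := ((M * L * K * expR (omega * t))%:E * (expR ((lambda - omega) * s))%:E)%E.
have f10 s : (0 <= f1 s)%E by rewrite mule_ge0// lee_fin mulr_ge0 ?expR_ge0.
have f20 s : (0 <= f2 s)%E by rewrite mule_ge0 ?weight_sum_ge0// lee_fin mulr_ge0 ?expR_ge0// mulr_ge0.
have f30 s : (0 <= f3 s)%E.
  by rewrite mule_ge0 ?lee_fin ?expR_ge0// mulr_ge0 ?expR_ge0// !mulr_ge0.
have mw := weight_sum_measurable.
have mexp : measurable_fun setT (fun s : R => (expR ((lambda - omega) * s))%:E).
  apply/measurable_EFinP; apply: measurableT_comp; first exact: measurable_expR.
  by apply: measurable_funM; [exact: measurable_cst|exact: measurable_id].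
have mf1 : measurable_fun setT f1 by apply: emeasurable_funM => //; exact: measurable_cst.
have mf2 : measurable_fun setT f2 by apply: emeasurable_funM => //; exact: measurable_cst.
have mf3 : measurable_fun setT f3 by apply: emeasurable_funM => //; exact: measurable_cst.
apply: (@le_trans _ _ (\int[mu]_(s in `[0%R, t]) (f1 s + (f2 s + f3 s)))%E).
  apply: ae_le_lower_integral.
  - by move=> s _; exact: majorant_ge0.
  - by move=> s _; rewrite !adde_ge0.
  apply: aeW => s; rewrite /= in_itv /= => /andP[s0 st].
  have st0 : 0 <= (lambda - omega) * (t - s) by rewrite mulr_ge0 ?subr_ge0// ltW.
  have ls0 : 0 <= lambda * s by rewrite mulr_ge0// ltW// (lt_trans Homega).
  have E1 : omega * (t - s) <= lambda * t by lra.
  (* The gap between the two sides is [(lambda - omega) * (t - s)]; [E1] follows by dropping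
     [lambda * s]. *)
  have E2 : omega * (t - s) + lambda * s <= lambda * t by lra.
  rewrite /majorant ge0_muleDr ?mule_ge0 ?adde_ge0 ?weight_sum_ge0 ?lee_fin ?mulr_ge0 ?expR_ge0//.
  apply: leeD.
    by apply: lee_wpmul2r => //; rewrite lee_fin ler_pM2l// ler_expR.
  rewrite ge0_muleDl ?weight_sum_ge0 ?lee_fin//.
  rewrite ge0_muleDr ?mule_ge0 ?weight_sum_ge0 ?lee_fin ?mulr_ge0 ?expR_ge0//.
  apply: leeD.
    rewrite muleCA muleC -EFinM; apply: lee_wpmul2r; first exact: weight_sum_ge0.
    rewrite lee_fin mulrACA -expRD; apply: ler_wpM2l; first by rewrite mulr_ge0.
    by rewrite ler_expR.
  rewrite /f3 -!EFinM lee_fin le_eqVlt; apply/orP; left; apply/eqP.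
  rewrite [RHS]mulrAC -!mulrA [in RHS]mulrC.
  rewrite (_ : omega * (t - s) = omega * t + (- omega * s)); last by ring.
  rewrite (_ : (lambda - omega) * s = lambda * s + (- omega * s)); last by ring.
  by rewrite !expRD; ring.
have mI : measurable (`[0%R, t]%classic : set R) by exact: measurable_itv.
rewrite ge0_integralD//; last 3 first.
- exact: measurable_funTS.
- by move=> s _; rewrite adde_ge0.
- by apply: measurable_funTS; exact: emeasurable_funD.
rewrite ge0_integralD//; last 2 first.
- exact: measurable_funTS.
- exact: measurable_funTS.
have sub (f : R -> \bar R) : measurable_fun setT f -> (forall s, 0 <= f s)%E ->
    (\int[mu]_(s in `[0%R, t]) f s <= \int[mu]_s f s)%E.
  by move=> mf f0; apply: ge0_subset_integral.
have i1 : (\int[mu]_(s in `[0%R, t]) f1 s <= (M * expR (lambda * t) * C)%:E)%E.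
  rewrite ge0_integralZl_EFin//; last 2 first.
  - exact: measurable_funTS.
  - by rewrite mulr_ge0// expR_ge0.
  rewrite [leRHS]EFinM lee_wpmul2l//; first by rewrite lee_fin mulr_ge0// expR_ge0.
  exact: le_trans (sub _ mg g0) gC.
have i2 : (\int[mu]_(s in `[0%R, t]) f2 s <= (M * K * expR (lambda * t) * kappa)%:E)%E.
  rewrite ge0_integralZl_EFin//; last 3 first.
  - by move=> s _; exact: weight_sum_ge0.
  - exact: measurable_funTS.
  - by rewrite mulr_ge0 ?expR_ge0// mulr_ge0.
  rewrite [leRHS]EFinM lee_wpmul2l//; first by rewrite lee_fin mulr_ge0 ?expR_ge0// mulr_ge0.
  exact: le_trans (sub _ mw weight_sum_ge0) intw.
have i3 : (\int[mu]_(s in `[0%R, t]) f3 s <=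
   (M * L * K * expR (omega * t) * (expR ((lambda - omega) * t) / (lambda - omega)))%:E)%E.
  rewrite ge0_integralZl_EFin//; last 2 first.
  - exact: measurable_funTS.
  - by rewrite mulr_ge0 ?expR_ge0// !mulr_ge0.
  rewrite [leRHS]EFinM lee_wpmul2l//; first by rewrite lee_fin mulr_ge0 ?expR_ge0// !mulr_ge0.
  exact: integral_expR_le.
apply: le_trans (leeD i1 (leeD i2 i3)) _.
rewrite -!EFinD lee_fin le_eqVlt; apply/orP; left; apply/eqP; rewrite qE.
rewrite (_ : expR (lambda * t) = expR (omega * t) * expR ((lambda - omega) * t)); last first.
  by rewrite -expRD; congr expR; ring.
by field; rewrite gt_eqF.
Qed.

Let lambda0 : 0 < lambda. Proof. exact: lt_trans lambda_gt. Qed.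

Lemma le_weight_expR K r s : 0 <= K -> r <= s -> K * expR (lambda * r) <= K * expR (lambda * s).
Proof. by move=> K0 rs; rewrite ler_wpM2l// ler_expR ler_pM2l. Qed.

Lemma duhamel_contraction (V W : R -> H) t K J1 J2 : 0 <= t -> 0 <= K ->
  {ae mu, forall s, 0 <= s -> cvgn (delay_series tau k B g V s)} ->
  {ae mu, forall s, 0 <= s -> cvgn (delay_series tau k B g W s)} ->
  (forall r, 0 <= r <= t -> `|V r - W r| <= K * expR (lambda * r)) ->
  is_bochner_integral mu `[0, t] (fun s => S (t - s) (source V s)) J1 ->
  is_bochner_integral mu `[0, t] (fun s => S (t - s) (source W s)) J2 ->
  `|J1 - J2| <= q * K * expR (lambda * t).
Proof.
move=> t0 K0 cV cW VW b1 b2.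
have m0 : measurable_fun setT (cst 0%E : R -> \bar R) by exact: measurable_cst.
rewrite -lee_fin.
apply: (@le_trans _ _ (\int[mu]_(s in `[0%R, t]) majorant (cst 0%E) t K s)%E); last first.
  apply: le_trans (@integral_majorant_le (cst 0%E) 0 t K t0 K0 m0 _ _) _ => //.
    by rewrite integral0.
  by rewrite lee_fin mulr0 add0r mulrC.
apply: (bochner_dist_le _ _ b1 b2).
- exact: measurable_itv.
- exact: lebesgue_measure_itvcc_lty.
- by apply: measurable_funTS; exact: majorant_measurable.
- by move=> s _; exact: majorant_ge0.
apply: (ae_imply2 _ good_ae (ae_imply2 (fun s h1 h2 => conj h1 h2) cV cW)).
move=> s gs [cVs cWs]; rewrite /= in_itv /= => /andP[s0 st].
rewrite /majorant add0e -linearB.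
apply: (@le_trans _ _ ((M * expR (omega * (t - s)))%:E * `|source V s - source W s|%:E)%E).
  by rewrite -EFinM lee_fin; apply: (semigroup_bound HS HSbound); rewrite subr_ge0.
apply: lee_wpmul2l; first by rewrite lee_fin mulr_ge0 ?expR_ge0// ltW.
apply: source_dist => //; [exact: gs|exact: cVs|exact: cWs|].
move=> r /andP[r0 rs]; apply: le_trans (VW r _) _; first by rewrite r0 (le_trans rs).
exact: le_weight_expR.
Qed.

(** Outside [good] times [limn] may be a meaningless value. With the cutoff, the partial sums
    converge at every time and the limit is measurable everywhere. *)
Definition good_source V s : H := if good s then source V s else 0.

Lemma F_continuous : continuous F.
Proof.
move=> x; apply: (@cvg_dist_squeeze _ _ _ _ _ _ (fun y => L * `|y - x|)); first exact: nearW.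
rewrite -(mulr0 L) -(normr0 H) -(subrr x); apply: cvgMr; apply: cvg_norm.
by apply: cvgB; [exact: cvg_id|exact: cvg_cst].
Qed.

(** * Measurability, integrability and continuity of the Duhamel integral *)

Section bounded_input.
Variables (V : R -> H) (K : R).
Hypothesis mV : strongly_measurable V.
Hypothesis K0 : 0 <= K.
Hypothesis VK : forall t, 0 <= t -> `|V t| <= K * expR (lambda * t).

Let VKs s r : 0 <= r <= s -> `|V r| <= K * expR (lambda * s).
Proof. by move=> /andP[r0 rs]; apply: le_trans (VK r0) _; exact: le_weight_expR. Qed.

Lemma delay_series_cvg_ae : {ae mu, forall s, 0 <= s -> cvgn (delay_series tau k B g V s)}.
Proof.
by apply: ae_imply good_ae => s gs s0; have [] := source_le (gs s0) (@VKs s).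
Qed.

Lemma good_source_strongly_measurable : strongly_measurable (good_source V).
Proof.
pose dext i s := if phi_ext tau c i s <= 0 then g_ext tau g i (phi_ext tau c i s)
  else B i (V (phi_ext tau c i s)).
have mphi i := phi_ext_measurable Htau_diff Hc i.
have mdext i : strongly_measurable (dext i).
  apply: strongly_measurable_if.
  - by apply: measurable_fun_ler => //; exact: measurable_cst.
  - exact: g_ext_strongly_measurable.
  - apply: (@strongly_measurable_comp _ _ _ _ _ (V \o phi_ext tau c i) (B i)).
      exact: bounded_op_continuous.
    exact: strongly_measurable_precomp.
have mterm i : strongly_measurable (fun s => k_ext k i s *: dext i s).
  apply: (@strongly_measurable_comp2 _ _ _ R^o H H (fun p => p.1 *: p.2) (k_ext k i : R -> R^o)) => //.
    exact: scale_continuous.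
  by apply: measurable_strongly_measurable; exact: k_ext_measurable.
have msum n : strongly_measurable (fun s => \sum_(0 <= i < n) k_ext k i s *: dext i s).
  elim: n => [|n IH].
    under eq_fun do rewrite big_nil; exact: strongly_measurable_cst.
  under eq_fun do rewrite big_nat_recr//=.
  apply: (@strongly_measurable_comp2 _ _ _ H H H (fun p => p.1 + p.2)) IH (mterm n).
  exact: add_continuous.
apply: (@strongly_measurable_lim _ _ _ _ (fun n s => if good s then
   \sum_(0 <= i < n) k_ext k i s *: dext i s + F (V s) else 0)).
  move=> n; apply: strongly_measurable_if; [exact: good_measurable| |exact: strongly_measurable_cst].
  apply: (@strongly_measurable_comp2 _ _ _ H H H (fun p => p.1 + p.2) _ (F \o V)).
  - exact: add_continuous.
  - exact: msum.
  - by apply: strongly_measurable_comp => //; exact: F_continuous.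
move=> s; rewrite /good_source; case: ifPn => gs; last exact: cvg_cst.
have /and3P[s0 _ _] := gs.
have [cv _] := source_le gs (@VKs s).
apply: cvgD; last exact: cvg_cst.
rewrite (_ : (fun n => _) = delay_series tau k B g V s) //.
apply/funext => n; rewrite /delay_series /series /=; apply: eq_bigr => i _.
by rewrite k_extE// delayedE.
Qed.

(** The second bound, from [expR (omega * (t - s)) >= 1], makes the source itself integrable, as the
    dominating function for continuity in time requires. *)
Lemma good_source_le t s : 0 <= s <= t ->
  (`|S (t - s) (good_source V s)|%:E <= majorant datum_sum t K s)%E /\
  (M%:E * `|good_source V s|%:E <= majorant datum_sum t K s)%E.
Proof.
move=> /andP[s0 st]; rewrite /good_source; case: ifPn => gs; last first.
  by rewrite linear0 !normr0 mule0; split; apply: majorant_ge0 => //; exact: datum_sum_ge0.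
have [_ le] := source_le gs (@VKs s).
have ts0 : 0 <= t - s by rewrite subr_ge0.
have e1 : 1 <= expR (omega * (t - s)) by rewrite -expR0 ler_expR mulr_ge0// ltW.
have M0 := ltW HM.
split.
  apply: (@le_trans _ _ ((M * expR (omega * (t - s)))%:E * `|source V s|%:E)%E).
    by rewrite -EFinM lee_fin; exact: (semigroup_bound HS HSbound).
  by apply: lee_wpmul2l => //; rewrite lee_fin mulr_ge0 ?expR_ge0.
apply: (@le_trans _ _ ((M * expR (omega * (t - s)))%:E * `|source V s|%:E)%E).
  by apply: lee_wpmul2r => //; rewrite lee_fin ler_peMr.
by apply: lee_wpmul2l => //; rewrite lee_fin mulr_ge0 ?expR_ge0.
Qed.

Let itv_meas t : measurable (`[0, t]%classic : set R).
Proof. exact: measurable_itv. Qed.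

Let itv_fin t : (mu `[0%R, t]%classic < +oo)%E.
Proof. exact: lebesgue_measure_itvcc_lty. Qed.

Lemma integral_majorant_fin t : 0 <= t ->
  (\int[mu]_(s in `[0%R, t]) majorant datum_sum t K s < +oo)%E.
Proof.
move=> t0; apply: le_lt_trans (integral_majorant_le t0 K0 datum_sum_measurable datum_sum_ge0 intd) _.
exact: ltry.
Qed.

Lemma good_source_integrable t : 0 <= t ->
  (\int[mu]_(s in `[0%R, t]) `|good_source V s|%:E < +oo)%E.
Proof.
move=> t0; have M1 : 0 <= M^-1 by rewrite invr_ge0 ltW.
have mm : measurable_fun setT (majorant datum_sum t K) by apply: majorant_measurable; exact: datum_sum_measurable.
apply: (@le_lt_trans _ _ (M^-1%:E * \int[mu]_(s in `[0%R, t]) majorant datum_sum t K s)%E); last first.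
  by apply: lte_mul_pinfty; rewrite ?lee_fin//; exact: integral_majorant_fin.
rewrite -ge0_integralZl_EFin//; last 2 first.
- by move=> s _; apply: majorant_ge0 => //; exact: datum_sum_ge0.
- exact: measurable_funTS.
apply: ae_le_lower_integral => //.
  by move=> s _; rewrite mule_ge0 ?lee_fin//; apply: majorant_ge0 => //; exact: datum_sum_ge0.
apply: aeW => s; rewrite /= in_itv /= => /good_source_le[_ le].
rewrite -[leLHS]mul1e -(mulVf (lt0r_neq0 HM)) EFinM -muleA.
by apply: lee_wpmul2l => //; rewrite lee_fin.
Qed.

(** The integrand at time [t], extended by 0 so that all [t] share one domain; the maximum fits it
    to [semigroup_continuous]. *)
Definition shifted t s : H :=
  if (0 <= s) && (s <= t) then S (Num.max (t - s) 0) (good_source V s) else 0.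

Lemma shifted_strongly_measurable t : strongly_measurable (shifted t).
Proof.
apply: strongly_measurable_if; [| |exact: strongly_measurable_cst].
  apply: measurable_and; apply: measurable_fun_ler;
    by [exact: measurable_cst|exact: measurable_id].
apply: (@strongly_measurable_comp2 _ _ _ R^o H H (fun p => S (Num.max p.1 0) p.2)
  (fun s : R => (t - s : R^o)) (good_source V)).
- exact: (semigroup_continuous HS HSbound).
- apply: measurable_strongly_measurable.
  by apply: measurable_funB; [exact: measurable_cst|exact: measurable_id].
- exact: good_source_strongly_measurable.
Qed.

Lemma shiftedE t s : 0 <= s <= t -> shifted t s = S (t - s) (good_source V s).
Proof.
move=> st; rewrite /shifted st; congr (S _ _); apply/max_idPl.
by move: st => /andP[_]; rewrite subr_ge0.
Qed.

Lemma source_shifted_ae t : {ae mu, forall s, `[0, t]%classic s ->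
  S (t - s) (source V s) = shifted t s}.
Proof.
apply: ae_imply good_ae => s gs; rewrite /= in_itv /= => st.
rewrite shiftedE// /good_source gs//.
by case/andP: st.
Qed.

Lemma duhamel_exists t : 0 <= t ->
  exists J, is_bochner_integral mu `[0, t] (fun s => S (t - s) (source V s)) J.
Proof.
move=> t0; apply: (@bochner_exists _ _ _ mu H `[0, t]%classic _ (shifted t)).
- exact: itv_meas.
- exact: itv_fin.
- exact: shifted_strongly_measurable.
- exact: source_shifted_ae.
apply: le_lt_trans (integral_majorant_fin t0).
apply: ae_le_lower_integral => //.
  by move=> s _; apply: majorant_ge0 => //; exact: datum_sum_ge0.
apply: aeW => s; rewrite /= in_itv /= => st.
by rewrite shiftedE//; have [] := good_source_le st.
Qed.

Lemma duhamel_norm_le t J : 0 <= t ->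
  is_bochner_integral mu `[0, t] (fun s => S (t - s) (source V s)) J ->
  `|J| <= expR (lambda * t) * (M * G + q * K).
Proof.
move=> t0 bJ; rewrite -lee_fin -[J]subr0.
apply: le_trans (integral_majorant_le t0 K0 datum_sum_measurable datum_sum_ge0 intd).
apply: (bochner_dist_le _ _ bJ (bochner_integral0 _ _ _)).
- exact: itv_meas.
- exact: itv_fin.
- by apply: measurable_funTS; apply: majorant_measurable; exact: datum_sum_measurable.
- by move=> s _; apply: majorant_ge0 => //; exact: datum_sum_ge0.
apply: (ae_imply _ (source_shifted_ae t)) => s h st; rewrite subr0 h//.
move: st; rewrite /= in_itv /= => st.
by rewrite shiftedE//; have [] := good_source_le st.
Qed.

Lemma shifted_le T t s : 0 <= t <= T ->
  `|shifted t s| <= M * expR (omega * T) * `|good_source V s|.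
Proof.
move=> /andP[t0 tT].
have Me : 0 <= M * expR (omega * T) by rewrite mulr_ge0 ?expR_ge0// ltW.
have [/andP[s0 st]|sn] := boolP ((0 <= s) && (s <= t)); last first.
  by rewrite /shifted (negbTE sn) normr0 mulr_ge0.
rewrite shiftedE ?s0//; have ts0 : 0 <= t - s by rewrite subr_ge0.
apply: le_trans (semigroup_bound HS HSbound _ ts0) _.
apply: ler_wpM2r => //; rewrite ler_pM2l// ler_expR ler_pM2l//.
by rewrite lerBlDr (le_trans tT)// lerDl.
Qed.

(** The case [s = t] is excluded because the extension by 0 may jump there; it is a single point. *)
Lemma shifted_cvg (v : nat -> R) t s : v n @[n --> \oo] --> t -> s != t ->
  shifted (v n) s @[n --> \oo] --> shifted t s.
Proof.
move=> vt; rewrite neq_lt => /orP[st|ts].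
  have [s0|s0] := leP 0 s; last first.
    rewrite /shifted leNgt s0 /=; exact: cvg_cst.
  rewrite {2}/shifted s0 (ltW st) /=.
  have cS : S (Num.max (v n - s) 0) (good_source V s) @[n --> \oo] -->
      S (Num.max (t - s) 0) (good_source V s).
    apply: (semigroup_cvg HS HSbound) => //.
    by apply: cvgB => //; exact: cvg_cst.
  apply: cvg_trans cS; apply: near_eq_cvg.
  have /cvgr_gt/(_ s st) := vt; apply: filterS => n sv.
  by rewrite /shifted s0 (ltW sv).
rewrite {2}/shifted [s <= t]leNgt ts andbF.
have c0 : cst (0 : H) n @[n --> \oo] --> (0 : H) by exact: cvg_cst.
apply: cvg_trans c0; apply: near_eq_cvg.
have /cvgr_lt/(_ s ts) := vt; apply: filterS => n sv.
by rewrite /shifted [s <= _]leNgt sv andbF.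
Qed.

(** All integrals are widened to one interval [[0, T]], where [shifted] converges off the point [t1]
    and differences are dominated by [2 * M * expR (omega * T)] times the norm of
    [good_source V]. *)
Lemma duhamel_continuous (J : R -> H) :
  (forall t, 0 <= t -> is_bochner_integral mu `[0, t] (fun s => S (t - s) (source V s)) (J t)) ->
  continuous (fun t : R => J (Num.max t 0)).
Proof.
move=> bJ t.
apply: cvg_seq_criterion => u ut.
pose v n := Num.max (u n) 0; pose t1 := Num.max t 0.
have vt : v n @[n --> \oo] --> t1.
  exact: (cvg_comp _ _ ut (@continuous_maxr_cst R 0 t)).
have v0 n : 0 <= v n by rewrite /v le_max lexx orbT.
have t10 : 0 <= t1 by rewrite /t1 le_max lexx orbT.
(* A convergent sequence is bounded, so a single [T] serves all [v n] and the limit. *)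
have [T [t1T vT]] : exists T, t1 <= T /\ forall n, v n <= T.
  have bv : bounded_fun v by apply: cvg_seq_bounded; apply/cvg_ex; exists t1.
  have [A A0 hA] := pinfty_ex_gt0 bv.
  exists (Num.max t1 A); split; first by rewrite le_max lexx.
  by move=> n; rewrite le_max (le_trans (ler_norm _) (hA n I)) orbT.
have T0 : 0 <= T by exact: le_trans t1T.
have wide r : 0 <= r <= T -> is_bochner_integral mu `[0, T]
    (fun s => if s \in `[0, r]%classic then S (r - s) (source V s) else 0) (J r).
  move=> /andP[r0 rT]; apply: (@bochner_widen _ _ _ mu H `[0, r]%classic).
  - exact: itv_meas.
  - by move=> s; rewrite /= !in_itv /= => /andP[-> /le_trans]; exact.
  - exact: bJ.
have wide_ae r : 0 <= r <= T -> {ae mu, forall s, `[0, T]%classic s ->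
    (if s \in `[0, r]%classic then S (r - s) (source V s) else 0) = shifted r s}.
  move=> _; apply: (ae_imply _ (source_shifted_ae r)) => s h _.
  rewrite mem_setE in_itv /=; case: ifPn => sr; first by apply: h; rewrite /= in_itv.
  by rewrite /shifted (negbTE sr).
pose w n s := `|shifted (v n) s - shifted t1 s|%:E.
have mw n : measurable_fun (`[0, T]%classic : set R) (w n).
  by apply: measurable_norm_dist; exact: shifted_strongly_measurable.
have vnT n : 0 <= v n <= T by rewrite v0 vT.
have t1T' : 0 <= t1 <= T by rewrite t10.
have le n : (`|J (v n) - J t1|%:E <= \int[mu]_(s in `[0%R, T]) w n s)%E.
  apply: (bochner_dist_le _ _ (wide _ (vnT n)) (wide _ t1T')).
  - exact: itv_meas.
  - exact: itv_fin.
  - exact: mw.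
  - by move=> s _; rewrite lee_fin.
  apply: (ae_imply2 _ (wide_ae _ (vnT n)) (wide_ae _ t1T')) => s h1 h2 sT.
  by rewrite h1// h2.
have mgs : measurable_fun (`[0, T]%classic : set R) (fun s => `|good_source V s|%:E).
  apply/measurable_EFinP/measurable_funTS/measurable_norm.
  exact: good_source_strongly_measurable.
have C0 : 0 <= 2 * (M * expR (omega * T)) by rewrite mulr_ge0// mulr_ge0 ?expR_ge0// ltW.
have I0 : (\int[mu]_(s in `[0%R, T]) w n s @[n --> \oo] --> 0)%E.
  have [|||||_ _] := @dominated_convergence _ _ _ mu `[0, T]%classic (itv_meas T)
    w (cst 0%E) (fun s => (2 * (M * expR (omega * T)))%:E * `|good_source V s|%:E)%E.
  - exact: mw.
  - exact: measurable_cst.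
  - have nt : {ae mu, forall s : R, s <> t1}.
      exists [set t1]; split; [exact: measurable_set1|exact: lebesgue_measure_set1|].
      by move=> s /= /contrapT.
    apply: (ae_imply _ nt) => s /eqP st _; apply: cvg_EFin; first exact: nearW.
    rewrite -(normr0 H) -(subrr (shifted t1 s)); apply: cvg_norm; apply: cvgB; last exact: cvg_cst.
    exact: shifted_cvg.
  - apply/integrableP; split.
      by apply: emeasurable_funM => //; exact: measurable_cst.
    under eq_integral do rewrite gee0_abs ?mule_ge0 ?lee_fin//.
    rewrite ge0_integralZl_EFin//.
    by apply: lte_mul_pinfty; rewrite ?lee_fin//; exact: good_source_integrable.
  - apply: aeW => s n _; rewrite /w /= normr_id -EFinM lee_fin.
    apply: le_trans (ler_normB _ _) _; rewrite -mulrA mulr_natl mulr2n.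
    by apply: lerD; apply: shifted_le.
  by rewrite integral0.
have h : (`|J (v n) - J t1|%:E @[n --> \oo] --> 0)%E.
  apply: (@squeeze_cvge _ _ _ _ (cst 0%E) _ (fun n => \int[mu]_(s in `[0%R, T]) w n s)%E) => //.
    by apply: nearW => n; rewrite lee_fin normr_ge0 le.
  exact: cvg_cst.
have /fine_cvgP[_ h'] := h.
by apply: (cvg_dist_squeeze _ _ h'); apply: nearW => n; exact: lexx.
Qed.

End bounded_input.

(** * Picard iteration and uniqueness *)

Definition admissible (V : R -> H) := strongly_measurable V /\
  exists2 K, 0 <= K & forall t, 0 <= t -> `|V t| <= K * expR (lambda * t).

Definition duhamel_image (V W : R -> H) := forall t, 0 <= t ->
  exists2 J, is_bochner_integral mu `[0, t] (fun s => S (t - s) (source V s)) J &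
    W t = S t U0 + J.

Let q0 : 0 <= q.
Proof.
rewrite qE addr_ge0//; first by rewrite mulr_ge0// ltW.
by rewrite divr_ge0 ?mulr_ge0 ?ltW// subr_gt0.
Qed.

Lemma admissible_cvg_ae V : admissible V ->
  {ae mu, forall s, 0 <= s -> cvgn (delay_series tau k B g V s)}.
Proof. by move=> [mV [K K0 VK]]; exact: (delay_series_cvg_ae K0 VK). Qed.

(** Admissibility asks for no continuity, so the pointwise limit of the iterates will qualify as an
    input; the image is continuous all the same. *)
Lemma duhamel_step V : admissible V ->
  exists W, [/\ admissible W, continuous W & duhamel_image V W].
Proof.
move=> [mV [K K0 VK]].
have /choice [J bJ] t : exists J, 0 <= t ->
    is_bochner_integral mu `[0, t] (fun s => S (t - s) (source V s)) J.
  have [t0|t0] := leP 0 t; last by exists 0.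
  by have [J hJ] := duhamel_exists mV K0 VK t0; exists J.
pose W (t : R) := S (Num.max t 0) U0 + J (Num.max t 0).
have cW : continuous W.
  move=> t; apply: cvgD; last exact: (duhamel_continuous mV K0 VK bJ).
  by apply: (semigroup_cvg HS HSbound) => //; exact: cvg_id.
exists W; split => //; last first.
  by move=> t t0; exists (J t); [exact: bJ|rewrite /W (max_idPl t0)].
split; first exact: continuous_strongly_measurable.
exists (M * `|U0| + (M * G + q * K)).
  by rewrite !addr_ge0// mulr_ge0// ltW.
move=> t t0; rewrite /W (max_idPl t0) mulrDl; apply: le_trans (ler_normD _ _) _.
apply: lerD; last by rewrite mulrC; exact: (duhamel_norm_le K0 VK t0 (bJ t t0)).
apply: le_trans (semigroup_bound HS HSbound _ t0) _.
rewrite [leRHS]mulrAC; apply: ler_wpM2r => //; rewrite ler_pM2l// ler_expR.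
by apply: ler_wpM2r => //; exact: ltW.
Qed.

(** The bound is assumed on [[0, t]] only. Uniqueness relies on this, as an arbitrary mild solution
    is not known to grow at most like [expR (lambda * r)]. *)
Lemma duhamel_image_dist (V V' W W' : R -> H) t K : 0 <= t -> 0 <= K ->
  {ae mu, forall s, 0 <= s -> cvgn (delay_series tau k B g V s)} ->
  {ae mu, forall s, 0 <= s -> cvgn (delay_series tau k B g V' s)} ->
  duhamel_image V W -> duhamel_image V' W' ->
  (forall r, 0 <= r <= t -> `|V r - V' r| <= K * expR (lambda * r)) ->
  `|W t - W' t| <= q * K * expR (lambda * t).
Proof.
move=> t0 K0 cV cV' VW VW' VV'.
have [J bJ ->] := VW t t0; have [J' bJ' ->] := VW' t t0.
rewrite opprD addrACA subrr add0r.
exact: (duhamel_contraction t0 K0 cV cV' VV' bJ bJ').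
Qed.

Hypothesis q1 : q < 1.

Lemma mild_solution_exists : exists U, mild_solution S tau k B F U0 g U.
Proof.
have /choice [Phi hPhi] V : exists W, admissible V ->
    [/\ admissible W, continuous W & duhamel_image V W].
  have [/duhamel_step[W hW]|nV] := pselect (admissible V); first by exists W.
  by exists V.
pose x := fix x n := if n is n'.+1 then Phi (x n') else (fun _ : R => 0 : H).
have adm n : admissible (x n).
  elim: n => [|n IH]; last by have [] := hPhi _ IH.
  split; first exact: strongly_measurable_cst.
  by exists 0 => // t _; rewrite /= normr0 mul0r.
have im n : duhamel_image (x n) (x n.+1) by have [] := hPhi _ (adm n).
(* As [x 0] is zero, the growth bound of [x 1] is also the first increment. *)
have [_ [K K0 hK]] := adm 1%N.
have q01 : 0 <= q < 1 by rewrite q0 q1.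
have step n t : 0 <= t -> `|x n.+1 t - x n t| <= K * expR (lambda * t) * q ^+ n.
  elim: n t => [|n IH] t t0; first by rewrite expr0 mulr1 subr0 hK.
  have := @duhamel_image_dist _ _ _ _ t (K * q ^+ n) t0 _ (admissible_cvg_ae (adm n.+1))
    (admissible_cvg_ae (adm n)) (im n.+1) (im n).
  rewrite (_ : _ * q ^+ n.+1 = q * (K * q ^+ n) * expR (lambda * t)); last by rewrite exprS; ring.
  apply; first by rewrite mulr_ge0// exprn_ge0.
  by move=> r /andP[r0 _]; rewrite mulrAC; exact: IH.
have /choice [U hU] t : exists l, 0 <= t -> forall n,
    `|l - x n t| <= K * expR (lambda * t) / (1 - q) * q ^+ n.
  have [t0|t0] := leP 0 t; last by exists 0.
  have [l hl] := geometric_limit (mulr_ge0 K0 (expR_ge0 (lambda * t))) q01 (fun n => step n t t0).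
  by exists l.
(* The limit is known for nonnegative times only; freezing it at its value at 0 before that makes it
   measurable on the line. *)
pose Um (t : R) := U (Num.max t 0).
have m0 (t : R) : 0 <= Num.max t 0 by rewrite le_max lexx orbT.
have mUm : strongly_measurable Um.
  apply: (@strongly_measurable_lim _ _ _ _ (fun n (t : R) => x n (Num.max t 0))).
    move=> n; apply: (@strongly_measurable_precomp _ _ _ _ _ _ (x n) (fun t : R => Num.max t 0)).
      by apply: measurable_maxr; [exact: measurable_id|exact: measurable_cst].
    by have [] := adm n.
  move=> t; apply: (@cvg_dist_squeeze _ _ _ _ _ _
    (geometric (K * expR (lambda * Num.max t 0) / (1 - q)) q)).
    by apply: nearW => n; rewrite distrC; exact: hU.
  by apply: cvg_geometric; rewrite ger0_norm.
pose K' := K / (1 - q).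
have K'0 : 0 <= K' by rewrite divr_ge0// subr_ge0 ltW.
have Ux n t : 0 <= t -> `|Um t - x n t| <= K' * q ^+ n * expR (lambda * t).
  move=> t0; rewrite /Um (max_idPl t0); apply: le_trans (hU t t0 n) _.
  by rewrite le_eqVlt; apply/orP; left; apply/eqP; rewrite /K'; ring.
have admU : admissible Um.
  split => //; exists K' => // t t0; have := Ux 0%N t t0.
  by rewrite /= subr0 expr0 mulr1.
have [W [_ cW imW]] := duhamel_step admU.
have WU t : 0 <= t -> W t = Um t.
  move=> t0; apply/eqP; rewrite -subr_eq0 -normr_le0.
  (* Both [W t] and [Um t] lie within [K' * q ^+ n.+1 * expR (lambda * t)] of [x n.+1 t], hence the
     factor [2 * q]. Continuity of [Um] is then inherited from [W]. *)
  apply: (@le_geometric0 _ _ (2 * q * K' * expR (lambda * t)) q) => // n.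
  rewrite (_ : W t - Um t = (W t - x n.+1 t) + (x n.+1 t - Um t)); last by rewrite addrA subrK.
  apply: le_trans (ler_normD _ _) _; rewrite [X in _ + X]distrC.
  have h1 : `|W t - x n.+1 t| <= q * (K' * q ^+ n) * expR (lambda * t).
    apply: (duhamel_image_dist t0 _ (admissible_cvg_ae admU) (admissible_cvg_ae (adm n)) imW (im n)).
      by rewrite mulr_ge0// exprn_ge0.
    by move=> r /andP[r0 _]; exact: Ux.
  have h2 := Ux n.+1 t t0; rewrite exprS in h2.
  by apply: le_trans (lerD h1 h2) _; rewrite le_eqVlt; apply/orP; left; apply/eqP; ring.
exists Um; split.
- apply: (@subspace_eq_continuous _ _ _ W); last exact: continuous_subspaceT.
  by move=> t; rewrite inE /= in_itv /= andbT => /WU.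
- exact: admissible_cvg_ae.
- by move=> t t0; have [J bJ WJ] := imW t t0; exists J => //; rewrite -WU.
Qed.

Lemma mild_solution_unique (U V : R -> H) :
  mild_solution S tau k B F U0 g U -> mild_solution S tau k B F U0 g V ->
  forall t, 0 <= t -> V t = U t.
Proof.
move=> [cU aU iU] [cV aV iV] t t0.
have q01 : 0 <= q < 1 by rewrite q0 q1.
have sub : `[0, t]%classic `<=` (`[0, +oo[%classic : set R).
  by move=> s; rewrite /= !in_itv /= => /andP[->].
(* Continuity on the compact interval gives a finite maximal distance, which starts the iteration
   because [expR (lambda * r) >= 1]. *)
have [m mt hm] : exists2 m, m \in `[0, t] & forall r, r \in `[0, t] -> `|V r - U r| <= `|V m - U m|.
  apply: (@EVT_max R (fun r => `|V r - U r|)) => //.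
  have cV' := continuous_subspaceW sub cV; have cU' := continuous_subspaceW sub cU.
  by move=> r; apply: cvg_norm; apply: cvgB; [exact: cV'|exact: cU'].
pose K := `|V m - U m|; have K0 : 0 <= K by exact: normr_ge0.
have imU : duhamel_image U U by [].
have imV : duhamel_image V V by [].
have bnd n r : 0 <= r <= t -> `|V r - U r| <= K * q ^+ n * expR (lambda * r).
  elim: n r => [|n IH] r rt.
    rewrite expr0 mulr1; apply: le_trans (hm r _) _; first by rewrite in_itv.
    rewrite ler_peMr// -expR0 ler_expR mulr_ge0 ?(ltW lambda0)//.
    by case/andP: rt.
  have /andP[r0 rt'] := rt.
  rewrite (_ : K * q ^+ n.+1 = q * (K * q ^+ n)); last by rewrite exprS; ring.
  apply: (duhamel_image_dist r0 _ aV aU imV imU); first by rewrite mulr_ge0// exprn_ge0.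
  by move=> p /andP[p0 pr]; apply: IH; rewrite p0 (le_trans pr).
apply/eqP; rewrite -subr_eq0 -normr_le0.
apply: (@le_geometric0 _ _ (K * expR (lambda * t)) q) => // n.
by rewrite mulrAC; apply: bnd; rewrite t0 lexx.
Qed.

End duhamel.

Theorem theorem1p1 (R : realType)
  (H : completeNormedModType R) (ip : {dot H for idfun})
  (Hip : forall x : H, `|x| ^+ 2 = ip x x)
  (DA : set H) (A : H -> H) (S : R -> {linear H -> H})
  (HS : C0_semigroup S) (HA : is_generator DA A S)
  (M omega : R) (HM : 0 < M) (Homega : 0 < omega)
  (HSbound : forall t : R, 0 <= t -> opnorm (S t) <= M * expR (omega * t))
  (tau : nat -> R -> R) (c : nat -> R)
  (Htau_ge0 : forall (i : nat) (t : R), 0 <= t -> 0 <= tau i t)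
  (Htau_diff : forall (i : nat) (t : R), 0 <= t ->
     exists2 l : R, is_derive_within `[0, +oo[ (tau i) t l & l <= c i)
  (Hc : forall i : nat, c i < 1)
  (B : nat -> {linear H -> H}) (HB : forall i : nat, bounded_op (B i))
  (k : nat -> R -> R) (Hk : forall i : nat, L1loc `[0, +oo[ (k i))
  (F : H -> H) (L : R) (HL : 0 < L) (HF : L.-lipschitz F) (HF0 : F 0 = 0)
  (U0 : H) (g : nat -> R -> H)
  (Hg : forall i : nat, {within delay_set tau, continuous (g i)})
  (Hsmall :
     (expeR (omega%:E * tau_star tau)
        * (\sum_(0 <= i <oo)
             \int[@lebesgue_measure R]_(z in
                 [set z : R | - tau_star tau < z%:E < 0])
               ((1 - c i)^-1 * abs_k_phi_inv tau k i z * `|g i z|)%:E)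
      + \sum_(0 <= i <oo)
          \int[@lebesgue_measure R]_(z in `[0%R, +oo[)
            (opnorm (B i) / (1 - c i) * abs_k_phi_inv tau k i z)%:E
      < M^-1%:E)%E) :
  exists U : R -> H,
    mild_solution S tau k B F U0 g U /\
    forall V : R -> H, mild_solution S tau k B F U0 g V ->
      forall t : R, 0 <= t -> V t = U t.
Proof.
have HF' x y : `|F x - F y| <= L * `|x - y| by exact: (HF (x, y) (conj I I)).
have [kappa [G [k0 Mk G0 iw id]]] := smallness_constants HM Homega Htau_ge0
  Htau_diff Hc HB Hk Hg Hsmall.
(* Chosen so that [M * L / (lambda - omega)] is half of [1 - M * kappa]; then [q] is the midpoint of
   [M * kappa] and 1. *)
pose lambda := omega + 2 * M * L / (1 - M * kappa).
pose q := M * kappa + M * L / (lambda - omega).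
have Mk0 : 0 < 1 - M * kappa by rewrite subr_gt0.
have lo : omega < lambda by rewrite ltrDl divr_gt0// !mulr_gt0.
have q1 : q < 1.
  have -> : q = (1 + M * kappa) / 2.
    have d : lambda - omega = 2 * M * L / (1 - M * kappa) by rewrite /lambda; ring.
    by rewrite /q d; field; rewrite !gt_eqF.
  by rewrite ltr_pdivrMr// mul1r; lra.
have qE : q = M * kappa + M * L / (lambda - omega) by [].
have [U mU] := mild_solution_exists HS HM Homega HSbound Htau_ge0 Htau_diff Hc
  HB Hk HL HF' HF0 U0 Hg k0 G0 iw id lo qE q1.
exists U; split => // V mV.
exact: (mild_solution_unique HS HM Homega HSbound Htau_ge0 Htau_diff Hc
  HB Hk HL HF' Hg k0 iw id lo qE q1 mU mV).
Qed.
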